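(* Let $X_n$, $n\in\mathbb{N}$, be a sequence of Polish spaces and let $d_n$ be a Borel pseudo-metric on $X_n$ for each $n$. Denote $E=E((X_n,d_n)_{n\in\mathbb{N}};0)$. Then (a) $\lim_{n\to\infty}\delta(X_n)=0$ and $( * )$ fails $\iff$ $E\sim_B E_0$ or $E$ is trivial; (b) $\lim_{n\to\infty}\delta(X_n)=0$ and $( * )$ holds $\iff$ $E_0^\omega\le_B E\le_B\mathbb{R}^{\mathbb{N}}/c_0$; (c) $(\delta(X_n))_{n\in\mathbb{N}}$ does not converge to $0\iff E_1\le_B E$. Here $( * )$ is the condition: for every $c>0$ there is $\varepsilon$ with $0<\varepsilon<c$ such that for infinitely many $i$ there exist $u_i,v_i\in X_i$ with $\varepsilon<d_i(u_i,v_i)<c$.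
   Context: Polish spaces (separable, completely metrizable spaces) are taken to be nonempty. A Borel pseudo-metric on $X_n$ is a pseudo-metric $d_n:X_n\times X_n\to[0,\infty)$ that is a Borel function; it need not be related to the topology of $X_n$. For pseudo-metric spaces $(X_n,d_n)$, $E((X_n,d_n)_{n\in\mathbb{N}};0)$ is the equivalence relation on $\prod_{n\in\mathbb{N}}X_n$ (with the product Polish topology) given by: $(x,y)\in E((X_n,d_n)_{n\in\mathbb{N}};0)$ iff $\lim_{n\to\infty}d_n(x(n),y(n))=0$. $E$ is trivial if all elements of $\prod_{n\in\mathbb{N}}X_n$ are $E$-equivalent. For $\delta>0$, $(X,d)$ is $\delta$-separable if there is a countable $S\subseteq X$ such that for every $u\in X$ there is $s\in S$ with $d(u,s)<\delta$. For a pseudo-metric space $(X,d)$, $\delta(X)=\inf\{\delta>0: X\text{ is }\delta\text{-separable}\}$ (with $\inf\emptyset=+\infty$). $E_0$ is the equivalence relation on $2^{\mathbb{N}}$: $(x,y)\in E_0\iff\exists m\,\forall n\ge m\,(x(n)=y(n))$. $E_1$ is the equivalence relation on $2^{\mathbb{N}\times\mathbb{N}}$: $(x,y)\in E_1\iff\exists m\,\forall n\ge m\,\forall k\,(x(n,k)=y(n,k))$. $E_0^\omega$ is the equivalence relation on $2^{\mathbb{N}\times\mathbb{N}}$: $(x,y)\in E_0^\omega\iff\forall k\,\exists m\,\forall n\ge m\,(x(n,k)=y(n,k))$. $\mathbb{R}^{\mathbb{N}}/c_0$ is the equivalence relation on $\mathbb{R}^{\mathbb{N}}$ given by $x\sim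 y$ iff $\lim_n(x(n)-y(n))=0$. For equivalence relations $E,F$ on Polish spaces $X,Y$, $E\le_B F$ ($E$ is Borel reducible to $F$) means there is a Borel function $\theta:X\to Y$ such that $(x,y)\in E\iff(\theta(x),\theta(y))\in F$ for all $x,y\in X$; $E\sim_B F$ means $E\le_B F$ and $F\le_B E$. *)

(* Defs.v *)
From HB Require Import structures.
From mathcomp Require Import all_boot all_order all_algebra.
From mathcomp Require Import all_classical all_reals all_analysis.

Set Implicit Arguments.
Unset Strict Implicit.
Unset Printing Implicit Defensive.

Import Order.TTheory GRing.Theory Num.Theory.
Import numFieldNormedType.Exports.

Local Open Scope classical_set_scope.
Local Open Scope ring_scope.

Record is_pseudometric (R : realType) (T : Type) (d : T -> T -> R) : Prop := {
  pseudometric_ge0 : forall x y, 0 <= d x y ;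
  pseudometric_refl : forall x, d x x = 0 ;
  pseudometric_sym : forall x y, d x y = d y x ;
  pseudometric_triangle : forall x y z, d x z <= d x y + d y z }.

Definition is_metric (R : realType) (T : Type) (d : T -> T -> R) : Prop :=
  is_pseudometric d /\ forall x y, d x y = 0 -> x = y.

Definition induces_topology (R : realType) (T : topologicalType)
    (d : T -> T -> R) : Prop :=
  forall A : set T, open A <->
    forall x, A x -> exists2 e : R, 0 < e & [set y | d x y < e] `<=` A.

Definition complete_distance (R : realType) (T : Type)
    (d : T -> T -> R) : Prop :=
  forall u : nat -> T,
    (forall e : R, 0 < e -> \forall m & n \near \oo, d (u m) (u n) < e) ->
    exists l : T, (fun n => d (u n) l) @ \oo --> (0 : R).

Definition completely_metrizable (R : realType) (T : topologicalType) : Prop :=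
  exists d : T -> T -> R,
    [/\ is_metric d, induces_topology d & complete_distance d].

Definition separable_space (T : topologicalType) : Prop :=
  exists2 S : set T, countable S & dense S.

Definition polish (R : realType) (T : topologicalType) : Prop :=
  [/\ [set: T] !=set0, separable_space T & completely_metrizable R T].

Definition borel_set (T : topologicalType) : set (set T) := <<s @open T >>.

Definition borel_fun (T U : topologicalType) (f : T -> U) : Prop :=
  forall B : set U, borel_set B -> borel_set (f @^-1` B).

(* d is not required to be continuous or related to the topology of T, which
   only determines the Borel structure. *)
Definition borel_pseudometric (R : realType) (T : topologicalType)
    (d : T -> T -> R) : Prop :=
  is_pseudometric d /\ borel_fun (fun p : T * T => d p.1 p.2).

Definition borel_reducible (T U : topologicalType)
    (E : T -> T -> Prop) (F : U -> U -> Prop) : Prop :=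
  exists2 theta : T -> U, borel_fun theta &
    forall x y, E x y <-> F (theta x) (theta y).

Definition borel_bireducible (T U : topologicalType)
    (E : T -> T -> Prop) (F : U -> U -> Prop) : Prop :=
  borel_reducible E F /\ borel_reducible F E.

(* All points are equivalent; not the equality relation. *)
Definition trivial_rel (T : Type) (E : T -> T -> Prop) : Prop :=
  forall x y, E x y.

Definition delta_separable (R : realType) (T : Type) (d : T -> T -> R)
    (delta : R) : Prop :=
  exists2 S : set T, countable S & forall u, exists2 s, S s & d u s < delta.

(* ereal_inf set0 = +oo, so delta_of d = +oo when d is delta-separable for
   no delta. *)
Definition delta_of (R : realType) (T : Type) (d : T -> T -> R) : \bar R :=
  ereal_inf [set delta%:E | delta in
    [set delta : R | 0 < delta /\ delta_separable d delta]].

(* E((X_n, d_n)_n; 0). *)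
Definition E_lim0 (R : realType) (X : nat -> topologicalType)
    (d : forall n, X n -> X n -> R) (x y : prod_topology X) : Prop :=
  (fun n => d n (x n) (y n)) @ \oo --> (0 : R).

Definition cond_star (R : realType) (X : nat -> topologicalType)
    (d : forall n, X n -> X n -> R) : Prop :=
  forall c : R, 0 < c -> exists2 eps : R, 0 < eps < c &
    infinite_set [set i | exists u v : X i, eps < d i u v < c].

Definition E_0 (x y : {ptws nat -> bool}) : Prop :=
  exists m, forall n, (m <= n)%N -> x n = y n.

Definition E_1 (x y : {ptws nat * nat -> bool}) : Prop :=
  exists m, forall n, (m <= n)%N -> forall k, x (n, k) = y (n, k).

Definition E_0_omega (x y : {ptws nat * nat -> bool}) : Prop :=
  forall k, exists m, forall n, (m <= n)%N -> x (n, k) = y (n, k).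

Definition RN_c0 (R : realType) (x y : {ptws nat -> R}) : Prop :=
  (fun n => x n - y n) @ \oo --> (0 : R).

(* Main.v *)
Require Import Defs.
From HB Require Import structures.
From mathcomp Require Import all_boot all_order all_algebra.
From mathcomp Require Import lra.
From mathcomp Require Import all_classical all_reals all_analysis.

(** The dichotomies come from two constructions and two obstructions.

    If [delta(X_n) -> 0], then [E <= R^N/c_0] by a form of Aharoni's embedding
    into [c_0]: for a sequence [s] that is [r]-dense in [X_n], the functions
    [max 0 (min (3r - d(u,s_i)) (min_(j<i) d(u,s_j) - r))] are 1-Lipschitz in
    [u], only finitely many of them are nonzero at a given [u], and they
    separate points at distance at least [5r] by [r].  If moreover (star)
    fails, then [d_n < c] is for large [n] an equivalence relation with
    countably many classes, and [E] is the corresponding tail equality.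

    If [X] is not [c]-separable, then the Borel graph [d >= c] is not a
    countable union of independent sets, so the [G_0] dichotomy yields a
    continuous homomorphism from [G_0].  The pullback of [d < c/2] then has
    meager sections, hence is meager, and Mycielski's theorem yields a Cantor
    set of points at mutual distance at least [c/2].  Putting such Cantor sets
    in infinitely many coordinates reduces [E_1] to [E].

    Conversely [E_1] does not reduce to [R^N/c_0] because the coset of a point
    is separable in the sup norm: on a comeager set one can modify one row
    after the other while moving the image by a summable amount.  And
    [E_0^omega] does not reduce to [E_0] because the classes of [E_0] are
    countable. *)

Set Implicit Arguments.
Unset Strict Implicit.
Unset Printing Implicit Defensive.

Import Order.TTheory GRing.Theory Num.Theory.
Import numFieldNormedType.Exports.

Local Open Scope classical_set_scope.
Local Open Scope ring_scope.

Local Notation cantor := {ptws nat -> bool}.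

(** * Product topologies and Baire category *)

Lemma cvg_prod_topologyP (I : Type) (K : I -> topologicalType)
    (F : set_system (prod_topology K)) (f : prod_topology K) : Filter F ->
  F --> f <-> forall i, (fun g : prod_topology K => g i) @ F --> f i.
Proof.
move=> FF; rewrite cvg_sup; split=> [h i|h i U].
  apply: cvg_trans (@initial_continuous _ _ (fun g : forall i, K i => g i) f).
  exact: cvg_app (h i).
have /= -> := @nbhsE (initial_topology (fun g : forall i, K i => g i)) f.
case=> B [[C oC <-] /= Cf] /filterS; apply; apply: h.
exact: open_nbhs_nbhs.
Qed.

Lemma proj_continuousT (I : Type) (K : I -> topologicalType) (i : I) :
  continuous (fun f : prod_topology K => f i).
Proof. by move=> f; apply: ((cvg_prod_topologyP f (nbhs_filter f)).1 _ i). Qed.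

Lemma continuous_prod_topology (T : topologicalType) (I : Type)
    (K : I -> topologicalType) (f : T -> prod_topology K) :
  (forall i, continuous (fun x => f x i)) -> continuous f.
Proof.
move=> fc x; apply/(@cvg_prod_topologyP _ K).
by move=> i; apply: fc.
Qed.

Section Cylinders.
Variables (I : countType) (D : discreteTopologicalType).
Local Notation T := {ptws I -> D}.

(** Cylinders are measured by the code of an index, so that a single number describes a basic
    neighbourhood for every countable index type. *)
Definition agree (l : nat) (x y : T) := forall p, (pickle p < l)%N -> x p = y p.

Lemma agree_refl l x : agree l x x. Proof. by []. Qed.

Lemma agree_sym l x y : agree l x y -> agree l y x.
Proof. by move=> h p /h. Qed.

Lemma agree_trans l x y z : agree l x y -> agree l y z -> agree l x z.
Proof. by move=> h k p lp; rewrite h// k. Qed.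

Lemma agree_le l m x y : (l <= m)%N -> agree m x y -> agree l x y.
Proof. by move=> lm h p pl; apply: h; apply: leq_trans lm. Qed.

Lemma agree_cvg (u : nat -> T) (x : T) :
  (forall n, agree n x (u n)) -> u @ \oo --> x.
Proof.
move=> h; apply/(@cvg_prod_topologyP _ (fun=> D)) => p A /nbhs_singleton Ax.
by exists (pickle p).+1 => // n /= pn; rewrite -h.
Qed.

Lemma nbhs_agree (x : T) (l : nat) : nbhs x [set y | agree l x y].
Proof.
elim: l => [|l IH]; first by apply: filterS filterT => y _ p.
case E : (unpickle l : option I) => [p|]; last first.
  apply: filterS IH => y h q; rewrite ltnS leq_eqVlt => /orP[/eqP ql|]; last exact: h.
  by move: E; rewrite -ql pickleK.
have : nbhs x [set y | x p = y p].
  apply: (@proj_continuousT I (fun=> D) p x [set d | x p = d]).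
  by rewrite nbhs_principalE.
move=> H; apply: filterS (filterI IH H) => y [h hp] q.
rewrite ltnS leq_eqVlt => /orP[/eqP ql|]; last exact: h.
by move: E; rewrite -ql pickleK => -[->].
Qed.

Lemma nbhs_agreeP (x : T) (A : set T) :
  nbhs x A <-> exists l, [set y | agree l x y] `<=` A.
Proof.
split=> [xA|[l lA]]; last exact: filterS (nbhs_agree x l).
apply: contrapT => /forallNP h.
have /choice[u hu] l : exists y, agree l x y /\ ~ A y.
  have := h l; rewrite -existsNP => -[y] /not_implyP[? ?].
  by exists y.
have := @agree_cvg u x (fun n => (hu n).1) A xA.
by case=> N _ /(_ N (leqnn N)) /=; case: (hu N).
Qed.

Lemma open_agree (x : T) (l : nat) : open [set y | agree l x y].
Proof.
rewrite openE => y xy; apply/nbhs_agreeP; exists l => z yz.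
exact: agree_trans xy yz.
Qed.

End Cylinders.

(** The limit step of the fusion arguments by cylinders below: the lengths increase strictly, so
    every coordinate is eventually frozen. *)
Lemma agree_lim (I : countType) (D : discreteTopologicalType)
    (x : nat -> {ptws I -> D}) (l : nat -> nat) :
  (forall n, (l n < l n.+1)%N /\ agree (l n) (x n) (x n.+1)) ->
  exists y : {ptws I -> D}, forall n, agree (l n) (x n) y.
Proof.
move=> h.
have lge n : (n <= l n)%N.
  by elim: n => // n IH; apply: leq_ltn_trans IH (h n).1.
have agr n m : (n <= m)%N -> agree (l n) (x n) (x m) /\ (l n <= l m)%N.
  move=> /subnK <-; elim: (m - n)%N => [|k [IH1 IH2]] //=.
  have [h1 h2] := h (k + n)%N; split; last exact: leq_trans IH2 (ltnW h1).
  by apply: agree_trans IH1 _; apply: agree_le h2.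
exists (fun p => x (pickle p).+1 p) => n p pn.
have [nm|mn] := leqP n (pickle p).+1; first exact: (agr _ _ nm).1.
by have [/(_ p)<-] := agr _ _ (ltnW mn).
Qed.

(** * Baire category and Borel sets *)

Section Baire_category.

Definition comeager (T : topologicalType) (C : set T) :=
  exists D : nat -> set T,
    (forall n, open (D n) /\ dense (D n)) /\ \bigcap_n D n `<=` C.

Definition baire_space (T : topologicalType) :=
  forall C : set T, comeager C -> dense C.

Definition countable_base (T : topologicalType) (B : nat -> set T) :=
  (forall n, open (B n)) /\
  forall x A, nbhs x A -> exists n, B n x /\ B n `<=` A.

Definition baire_property (T : topologicalType) (B : set T) :=
  exists U, open U /\ comeager [set x | B x <-> U x].

Variable T : topologicalType.
Implicit Types C B U : set T.

Lemma comeagerS B C : B `<=` C -> comeager B -> comeager C.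
Proof.
by move=> BC [D [oD DB]]; exists D; split => //; apply: subset_trans BC.
Qed.

Lemma comeager_open U : open U -> dense U -> comeager U.
Proof. by move=> oU dU; exists (fun=> U); split => // x /(_ 0%N I). Qed.

Lemma comeagerT : comeager [set: T].
Proof.
by apply: comeager_open; [exact: openT | move=> O O0 _; rewrite setIT].
Qed.

Lemma comeager_bigcap (I : countType) (C : I -> set T) :
  (forall i, comeager (C i)) -> comeager (\bigcap_i C i).
Proof.
move=> /choice[D hD].
exists (fun n => if unpickle n is Some p then D p.1 p.2 else setT); split.
  move=> n; case: (unpickle n) => [p|]; first exact: (hD p.1).1.
  by split; [exact: openT | move=> O O0 _; rewrite setIT].
move=> x hx i _; apply: (hD i).2 => m _.
by have := hx (pickle (i, m)) Logic.I; rewrite pickleK.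
Qed.

Lemma comeagerI B C : comeager B -> comeager C -> comeager (B `&` C).
Proof.
move=> cB cC; apply: comeagerS (@comeager_bigcap bool (fun b => if b then B else C) _).
  by move=> x h; split; [exact: (h true) | exact: (h false)].
by case.
Qed.

Lemma borel_ind (P : set T -> Prop) :
  (forall U, open U -> P U) -> (forall A, P A -> P (~` A)) ->
  (forall F : nat -> set T, (forall n, P (F n)) -> P (\bigcup_n F n)) ->
  forall B, borel_set B -> P B.
Proof.
move=> Po PC PU.
suff : borel_set (T := T) `<=` [set A | P A] by [].
apply: smallest_sub => //; split => //.
  exact/Po/open0.
by move=> A PA; rewrite setTD; apply: PC.
Qed.

Lemma borel_open U : open U -> borel_set U.
Proof. exact: sub_sigma_algebra. Qed.

Lemma borel_setC B : borel_set B -> borel_set (~` B).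
Proof. by move=> hB; rewrite -setTD; apply: sigma_algebraCD. Qed.

Lemma borel_bigcup (I : countType) (F : I -> set T) :
  (forall i, borel_set (F i)) -> borel_set (\bigcup_i F i).
Proof.
move=> hF.
have -> : \bigcup_i F i =
    \bigcup_n (if unpickle n is Some i then F i else set0).
  apply/seteqP; split=> [x [i _ Fx]|x [n _]].
    by exists (pickle i) => //; rewrite pickleK.
  by case: (unpickle n) => // i Fx; exists i.
apply: sigma_algebra_bigcup => n; case: (unpickle n) => [i|]; first exact: hF.
by apply: borel_open; exact: open0.
Qed.

Lemma borel_bigcap (I : countType) (F : I -> set T) :
  (forall i, borel_set (F i)) -> borel_set (\bigcap_i F i).
Proof.
move=> hF; rewrite -[X in borel_set X]setCK setC_bigcap.
by apply: borel_setC; apply: borel_bigcup => i; apply: borel_setC.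
Qed.

Lemma borel_setI A B : borel_set A -> borel_set B -> borel_set (A `&` B).
Proof.
move=> hA hB; have -> : A `&` B = \bigcap_(b : bool) (if b then A else B).
  apply/seteqP; split=> [x [Ax Bx] [] //|x h].
  by split; [exact: (h true) | exact: (h false)].
by apply: borel_bigcap => -[].
Qed.

(** The sets with the Baire property form a sigma-algebra. For a complement, [U] is replaced by the
    interior of its complement, since [U] together with that interior is open and dense. *)
Lemma baire_property_borel B : borel_set B -> baire_property B.
Proof.
apply: borel_ind => [U oU|A [U [oU cU]]|F /choice[U hU]].
- by exists U; split => //; apply: comeagerS comeagerT.
- exists (~` U)°; split; first exact: open_interior.
  have cV : comeager (U `|` (~` U)°).
    apply: comeager_open; first by apply: openU => //; exact: open_interior.
    move=> O [x Ox] oO; have [[y [Oy Uy]]|/forallNP h] := pselect (exists y, O y /\ U y).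
      by exists y; split => //; left.
    exists x; split => //; right; rewrite /interior nbhsE; exists O => //= y Oy Uy.
    exact: (h y).
  apply: comeagerS (comeagerI cU cV) => x /= [AU UV].
  split=> [nA|/interior_subset nU /AU//].
  by case: UV => // /AU.
- exists (\bigcup_n U n); split; first by apply: bigcup_open => n _; apply: (hU n).1.
  apply: comeagerS (comeager_bigcap (fun n => (hU n).2)) => x /= h.
  by split=> -[n _ hn]; exists n => //; apply/(h n Logic.I).
Qed.

End Baire_category.

(** Openness of [f] carries density back: the image of a nonempty open set is open, so it meets each
    dense open set. *)
Lemma comeager_preimage (S T : topologicalType) (f : S -> T) (C : set T) :
  continuous f -> (forall A, open A -> open (f @` A)) ->
  comeager C -> comeager (f @^-1` C).
Proof.
move=> fc fo [D [oD DC]]; exists (fun n => f @^-1` D n); split; last first.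
  by move=> x hx; apply: DC => n _; apply: hx.
move=> n; have [on dn] := oD n; split; first by apply: open_comp => // ? _; apply: fc.
move=> O [x Ox] oO; have [|_ [[y Oy <-] Dy]] := dn _ _ (fo _ oO).
  by exists (f x); exists x.
by exists y.
Qed.

(** Half of the Kuratowski-Ulam theorem. The points whose section of [D n] meets [B m] form the
    projection of an open set, and they are dense because [D n] meets every box over [B m]. A point
    in all these sets has dense open sections. *)
Lemma comeager_sections (S T : topologicalType) (B : nat -> set T)
    (C : set (S * T)) : countable_base B -> comeager C ->
  comeager [set x | comeager [set y | C (x, y)]].
Proof.
move=> [oB bB] [D [oD DC]].
pose E (p : nat * nat) : set S :=
  [set x | B p.1 !=set0 -> exists2 y, B p.1 y & D p.2 (x, y)].
have cE p : comeager (E p).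
  case: p => m n; have [Bm|Bm] := pselect (B m !=set0); last first.
    by apply: comeagerS (comeagerT S) => x _ /Bm.
  have [on dn] := oD n.
  have -> : E (m, n) = fst @` (D n `&` snd @^-1` B m).
    apply/seteqP; split=> [x /(_ Bm)[y By Dy]|_ [[x y] [/= Dy By] <-] _]; last by exists y.
    by exists (x, y).
  apply: comeager_open.
    apply: fst_open; apply: openI => //; apply: open_comp => // p _; exact: cvg_snd.
  move=> O [x Ox] oO; have [y By] := Bm.
  have [||p [[Op Bp] Dp]] := dn (O `*` B m).
  - by exists (x, y).
  - rewrite openE => -[a b] [/= Oa Bb]; exists (O, B m) => //=; split.
      exact: open_nbhs_nbhs.
    exact: open_nbhs_nbhs.
  - by exists p.1; split => //; exists p.
apply: comeagerS (comeager_bigcap cE) => x hx /=.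
exists (fun n => [set y | D n (x, y)]); split; last by move=> y hy; apply: DC.
move=> n; split.
  apply: (@open_comp _ _ (fun y => (x, y))); last exact: (oD n).1.
  by move=> y _; apply: cvg_pair; [exact: cvg_cst | exact: cvg_id].
move=> O [y Oy] oO; have [m [Bmy BmO]] := bB y O (open_nbhs_nbhs (conj oO Oy)).
have [|z Bz Dz] := hx (m, n) Logic.I; first by exists y.
by exists z; split => //; apply: BmO.
Qed.

(** Each step shrinks the current cylinder into the next dense open set, and [agree_lim] gives the
    common point. *)
Lemma baire_space_ptws (I : countType) (D : discreteTopologicalType) :
  baire_space {ptws I -> D}.
Proof.
move=> C [E [oE EC]] O [x0 Ox0] oO.
have step (p : nat * ({ptws I -> D} * nat)) : exists q : {ptws I -> D} * nat,
    [/\ (p.2.2 < q.2)%N, agree p.2.2 p.2.1 q.1 &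
      [set y | agree q.2 q.1 y] `<=` E p.1].
  case: p => n [x l] /=.
  have [||y [/= xy Ey]] := (oE n).2 [set y | agree l x y].
  - by exists x; apply: agree_refl.
  - exact: open_agree.
  have /nbhs_agreeP[m hm] : nbhs y (E n).
    by apply: open_nbhs_nbhs; split => //; exact: (oE n).1.
  exists (y, maxn l.+1 m); split => //=; first by rewrite leq_max leqnn.
  by move=> z /(agree_le (leq_maxr _ _)); apply: hm.
have [f hf] := choice step.
have /nbhs_agreeP[l0 hl0] : nbhs x0 O by apply: open_nbhs_nbhs.
pose u := fix u n := if n is m.+1 then f (m, u m) else (x0, l0).
have [y hy] := @agree_lim I D (fun n => (u n).1) (fun n => (u n).2)
  (fun n => let: And3 a b _ := hf (n, u n) in conj a b).
exists y; split; first exact/hl0/(hy 0%N).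
apply: EC => n _; have [_ _ ] := hf (n, u n); apply; exact: (hy n.+1).
Qed.

(** * Borel functions into countable products *)

Lemma countable_base_discrete (D : discreteTopologicalType) (e : nat -> D) :
  (forall d, exists n, e n = d) -> countable_base (fun n => [set e n]).
Proof.
move=> he; split=> [n|x A /nbhs_singleton Ax]; first exact: discrete_open.
by have [n en] := he x; exists n; split; rewrite ?en // => y ->.
Qed.

Definition rat_ball (R : realType) (n : nat) : set R :=
  if unpickle n is Some p then ball (ratr p.1 : R) (p.2.+1%:R^-1 : R) else set0.

Lemma countable_base_real (R : realType) : countable_base (@rat_ball R).
Proof.
split=> [n|x A /nbhs_ballP[e /= e0 eA]].
  rewrite /rat_ball; case: (unpickle n) => [p|]; last exact: open0.
  exact: ball_open.
have e2 : 0 < e / 2 by rewrite divr_gt0.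
have [n] := ltr_add_invr e2; rewrite add0r => hn.
have n0 : 0 < n.+1%:R^-1 :> R by rewrite invr_gt0.
have /dense_rat : (ball x (n.+1%:R^-1 : R)) !=set0 by exists x; apply: ballxx.
move=> /(_ (ball_open x _))[z [+ [q _ qz]]]; rewrite -{}qz => bq.
exists (pickle (q, n)); rewrite /rat_ball pickleK; split; first exact: ball_sym.
move=> y yq; apply: eA; rewrite [e]splitr.
apply: ball_triangle (le_ball (ltW hn) bq) (le_ball (ltW hn) yq).
Qed.

Section Cylinder_base.
Variables (I : countType) (U : topologicalType) (B : nat -> set U).
Hypothesis bB : countable_base B.
Local Notation T := {ptws I -> U}.

Definition cyl_base (n : nat) : set T :=
  if @unpickle (seq (I * nat)) n is Some s
  then [set f | forall p, p \in s -> B p.2 (f p.1)] else set0.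

Lemma cyl_base_nbhs (x : T) (A : set T) :
  nbhs x A -> exists n, cyl_base n x /\ cyl_base n `<=` A.
Proof.
move=> xA.
pose s l := [seq p <- [seq (i, n) | i <- pmap unpickle (iota 0 l), n <- iota 0 l] |
  `[< B p.2 (x p.1) >]] : seq (I * nat).
have sB l p : p \in s l -> B p.2 (x p.1) by rewrite mem_filter => /andP[/asboolP].
have sP l i n : (pickle i < l)%N -> (n < l)%N -> B n (x i) -> (i, n) \in s l.
  move=> il nl Bn; rewrite mem_filter; apply/andP; split; first exact/asboolP.
  apply/allpairsP; exists (i, n); split => //=; last by rewrite mem_iota.
  by rewrite mem_pmap; apply/mapP; exists (pickle i); rewrite ?pickleK // mem_iota.
apply: contrapT => /forallNP h.
have /choice[u hu] l : exists y : T, (forall p, p \in s l -> B p.2 (y p.1)) /\ ~ A y.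
  apply: contrapT => /forallNP hl; apply: (h (pickle (s l))).
  rewrite /cyl_base pickleK; split=> [p /sB//|y hy].
  by apply: contrapT => nAy; apply: (hl y).
have : u @ \oo --> x.
  apply/(@cvg_prod_topologyP _ (fun=> U)) => i V.
  move=> /(bB.2 _ _)[n [Bn nV]]; exists (maxn (pickle i) n).+1 => // l /= hl.
  apply: nV; apply: ((hu l).1 (i, n)); apply: sP => //.
    by apply: leq_trans hl; rewrite ltnS leq_maxl.
  by apply: leq_trans hl; rewrite ltnS leq_maxr.
move=> /(_ A xA)[N _ /(_ N (leqnn N))] /=; exact: (hu N).2.
Qed.

Lemma cyl_base_open n : open (cyl_base n).
Proof.
rewrite /cyl_base; case: (unpickle n) => [s|]; last exact: open0.
have -> : [set f : T | forall p, p \in s -> B p.2 (f p.1)] =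
    \big[setI/setT]_(p <- s) [set f | B p.2 (f p.1)].
  elim: s => [|p s IH]; first by rewrite big_nil; apply/seteqP; split.
  rewrite big_cons -IH; apply/seteqP; split=> f /=.
    by move=> h; split=> [|q qs]; apply: h; rewrite inE ?eqxx // qs orbT.
  by move=> [h1 h2] q; rewrite inE => /orP[/eqP->|/h2].
apply: big_ind => [|V W|p _]; [exact: openT | exact: openI |].
by apply: (@open_comp T U) (bB.1 p.2) => f _; exact: (@proj_continuousT I (fun=> U)).
Qed.

Lemma countable_base_ptws : countable_base cyl_base.
Proof. by split; [exact: cyl_base_open | exact: cyl_base_nbhs]. Qed.

End Cylinder_base.

Section Borel_functions.

Lemma borel_fun_open (T U : topologicalType) (f : T -> U) :
  (forall V, open V -> borel_set (f @^-1` V)) -> borel_fun f.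
Proof.
move=> hf; apply: borel_ind => // [A|F]; first by rewrite preimage_setC; exact: borel_setC.
by rewrite preimage_bigcup => h; apply: borel_bigcup.
Qed.

Lemma borel_fun_continuous (T U : topologicalType) (f : T -> U) :
  continuous f -> borel_fun f.
Proof.
move=> fc; apply: borel_fun_open => V oV; apply: borel_open.
by apply: open_comp => // x _; exact: fc.
Qed.

Lemma borel_fun_comp (T U V : topologicalType) (f : T -> U) (g : U -> V) :
  borel_fun f -> borel_fun g -> borel_fun (g \o f).
Proof. by move=> hf hg B /hg/hf. Qed.

(** An open subset of the product is a countable union of basic cylinders, whose preimages are
    finite intersections of conditions on single coordinates. *)
Lemma borel_fun_ptws (T U : topologicalType) (I : countType) (B : nat -> set U)
    (f : T -> {ptws I -> U}) : countable_base B ->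
  (forall i, borel_fun (fun x => f x i)) -> borel_fun f.
Proof.
move=> bB hf; apply: borel_fun_open => V oV.
pose F n := if `[< cyl_base B n `<=` V >] then cyl_base B n else set0 : set {ptws I -> U}.
have -> : V = \bigcup_n F n.
  apply/seteqP; split=> [x Vx|x [n _]]; rewrite /F; last by case: asboolP => // h /h.
  have [n [Bx BV]] := cyl_base_nbhs bB (open_nbhs_nbhs (conj oV Vx)).
  by exists n => //; rewrite asboolT.
rewrite preimage_bigcup; apply: borel_bigcup => n; rewrite /F.
case: asboolP => _; last by rewrite preimage_set0; apply: borel_open; exact: open0.
rewrite /cyl_base; case: (unpickle n) => [s|]; last first.
  by rewrite preimage_set0; apply: borel_open; exact: open0.
elim: s => [|p s IH].
  have -> : f @^-1` [set g : {ptws I -> U} | forall p, p \in [::] -> B p.2 (g p.1)] = setT.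
    by apply/seteqP; split.
  by apply: borel_open; exact: openT.
have -> : f @^-1` [set g | forall q, q \in p :: s -> B q.2 (g q.1)] =
   (fun x => f x p.1) @^-1` B p.2 `&` f @^-1` [set g | forall q, q \in s -> B q.2 (g q.1)].
  apply/seteqP; split=> x /=.
    by move=> h; split=> [|q qs]; apply: h; rewrite inE ?eqxx // qs orbT.
  by move=> [h1 h2] q; rewrite inE => /orP[/eqP->|/h2].
by apply: borel_setI => //; apply: hf; apply: borel_open; exact: bB.1.
Qed.

Lemma borel_fun_bool (T : topologicalType) (f : T -> bool) :
  borel_set [set x | f x] -> borel_fun f.
Proof.
move=> hf; apply: borel_fun_open => V _.
have -> : f @^-1` V = ([set x | f x] `&` [set x | V true]) `|`
    (~` [set x | f x] `&` [set x | V false]).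
  apply/seteqP; split=> x /=; first by case: (f x) => ?; [left|right].
  by case=> -[]; case: (f x).
have cst (P : Prop) : borel_set [set _ : T | P].
  have [p|np] := pselect P.
    have -> : [set _ : T | P] = setT by apply/seteqP; split.
    by apply: borel_open; exact: openT.
  have -> : [set _ : T | P] = set0 by apply/seteqP; split.
  by apply: borel_open; exact: open0.
have -> (A B : set T) : A `|` B = ~` (~` A `&` ~` B) by rewrite -setCU setCK.
by apply: borel_setC; apply: borel_setI; apply: borel_setC; apply: borel_setI => //;
  apply: borel_setC.
Qed.

Variable R : realType.

(** The plane is represented as [{ptws bool -> R}], so that [borel_fun_ptws] applies to a pair of
    functions. *)
Lemma borel_fun_real2 (T : topologicalType) (h : R -> R -> R) (f g : T -> R) :
  continuous (fun p : {ptws bool -> R} => h (p true) (p false)) ->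
  borel_fun f -> borel_fun g -> borel_fun (fun x => h (f x) (g x)).
Proof.
move=> hc hf hg.
have := @borel_fun_comp T {ptws bool -> R} R (fun x b => if b then f x else g x) _ _
  (borel_fun_continuous hc).
apply; apply: (borel_fun_ptws (@countable_base_real R)) => -[] //.
Qed.

Lemma borel_funB (T : topologicalType) (f g : T -> R) :
  borel_fun f -> borel_fun g -> borel_fun (fun x => f x - g x).
Proof.
apply: (@borel_fun_real2 _ (fun a b => a - b)) => p.
have pc b : (fun g : {ptws bool -> R} => g b) @ p --> (p b : R).
  exact: (@proj_continuousT bool (fun=> R)).
exact: (cvgB (pc true) (pc false)).
Qed.

Lemma borel_fun_min (T : topologicalType) (f g : T -> R) :
  borel_fun f -> borel_fun g -> borel_fun (fun x => Num.min (f x) (g x)).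
Proof.
apply: (@borel_fun_real2 _ Num.min) => p.
have pc b : {for p, continuous (fun g : {ptws bool -> R} => (g b : R))}.
  exact: (@proj_continuousT bool (fun=> R)).
exact: (continuous_min (pc true) (pc false)).
Qed.

Lemma borel_fun_max (T : topologicalType) (f g : T -> R) :
  borel_fun f -> borel_fun g -> borel_fun (fun x => Num.max (f x) (g x)).
Proof.
apply: (@borel_fun_real2 _ Num.max) => p.
have pc b : {for p, continuous (fun g : {ptws bool -> R} => (g b : R))}.
  exact: (@proj_continuousT bool (fun=> R)).
exact: (continuous_max (pc true) (pc false)).
Qed.

Lemma borel_fun_cst (T U : topologicalType) (u : U) : borel_fun (fun _ : T => u).
Proof. by apply: borel_fun_continuous => x; exact: cvg_cst. Qed.

Lemma borel_lt (T : topologicalType) (f : T -> R) (c : R) :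
  borel_fun f -> borel_set [set x | f x < c].
Proof. by move=> /(_ [set y | y < c]); apply; apply: borel_open; exact: open_lt. Qed.

Lemma borel_le (T : topologicalType) (f : T -> R) (c : R) :
  borel_fun f -> borel_set [set x | f x <= c].
Proof.
move=> /(_ [set y | y > c]) hf.
have -> : [set x | f x <= c] = ~` (f @^-1` [set y | y > c]).
  by apply/seteqP; split=> x /=; rewrite leNgt => /negP.
by apply: borel_setC; apply: hf; apply: borel_open; exact: open_gt.
Qed.

End Borel_functions.

(** * Souslin sets *)

Lemma countable_enum (T : Type) (S : set T) : countable S -> S !=set0 ->
  exists q : nat -> T, (forall n, S (q n)) /\ forall x, S x -> exists n, q n = x.
Proof.
move=> /countable_injP[f fi] [x0 Sx0].
have /choice[q hq] n : exists x, S x /\ ((exists2 y, S y & f y = n) -> f x = n).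
  have [[y Sy fy]|h] := pselect (exists2 y, S y & f y = n); first by exists y.
  by exists x0; split => // /h.
exists q; split=> [n|x Sx]; first exact: (hq n).1.
exists (f x); apply: fi; rewrite ?inE //; first exact: (hq _).1.
by apply: (hq _).2; exists x.
Qed.

Section Metric_topology.
Variables (R : realType) (X : topologicalType) (rho : X -> X -> R).
Hypotheses (hm : is_metric rho) (ht : induces_topology rho).

Lemma induces_nbhs (x : X) (A : set X) :
  nbhs x A <-> exists2 e : R, 0 < e & [set y | rho x y < e] `<=` A.
Proof.
have [[_ rr _ tri] _] := hm; split.
  rewrite nbhsE => -[B [/ht oB Bx] BA]; have [e e0 eB] := oB x Bx.
  by exists e => //; apply: subset_trans BA.
case=> e e0 eA; rewrite nbhsE; exists [set y | rho x y < e] => //; split; last first.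
  by rewrite /= rr.
apply/ht => y /= xy; exists (e - rho x y); first by rewrite subr_gt0.
move=> z /=; rewrite ltrBrDl; apply: le_lt_trans; exact: tri.
Qed.

Lemma induces_cvg (u : nat -> X) (x : X) :
  (fun n => rho (u n) x) @ \oo --> (0 : R) -> u @ \oo --> x.
Proof.
have [[_ _ sy _] _] := hm => /cvgrPdist_lt h A /induces_nbhs[e e0 eA].
have := h e e0; apply: filterS => n /=; rewrite sub0r normrN sy => le.
by apply: eA => /=; apply: le_lt_trans le; apply: ler_norm.
Qed.

Lemma closed_metric_ball (x : X) (r : R) : closed [set y | rho x y <= r].
Proof.
have [[_ _ sy tri] _] := hm.
rewrite -[X in closed X]setCK; apply: open_closedC; apply/ht => y /= /negP.
rewrite -ltNge => ry; exists (rho x y - r); first by rewrite subr_gt0.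
move=> z /= h; apply/negP; rewrite -ltNge.
by have := tri x z y; rewrite [rho z y]sy; lra.
Qed.

End Metric_topology.

Lemma polish_metric (R : realType) (X : topologicalType) : polish R X ->
  exists (rho : X -> X -> R) (q : nat -> X), [/\ is_metric rho, induces_topology rho,
    complete_distance rho & forall x (e : R), 0 < e -> exists n, rho (q n) x < e].
Proof.
move=> [[x0 _] [S cS dS] [rho [hm ht hc]]].
have [|q [Sq hq]] := countable_enum cS.
  by have [||x [_ Sx]] := dS setT; [exists x0 | exact: openT | exists x].
exists rho, q; split => // x e e0.
have [[_ rr sy tri] _] := hm.
have [||y [xy Sy]] := dS ([set y | rho x y < e]°).
- by exists x; rewrite /interior; apply/(induces_nbhs hm ht); exists e.
- exact: open_interior.
by have [n qn] := hq y Sy; exists n; rewrite qn sy; apply: (interior_subset xy).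
Qed.

Lemma closed_preimage (S T : topologicalType) (f : S -> T) (D : set T) :
  continuous f -> closed D -> closed (f @^-1` D).
Proof.
move=> fc /closed_openC cD; rewrite -[X in closed X]setCK preimage_setC.
by apply: open_closedC; apply: open_comp => // x _; exact: fc.
Qed.

Section Souslin.
Local Notation NN := {ptws nat -> nat}.

Definition souslin (Z : topologicalType) (B : set Z) :=
  exists K : set (Z * NN), closed K /\ forall z, B z <-> exists f, K (z, f).

Variable Z : topologicalType.
Implicit Types B : set Z.

Lemma souslin_closed B : closed B -> souslin B.
Proof.
move=> cB; exists (fst @^-1` B); split=> [|z]; last by split=> [Bz|[]//]; exists (fun=> 0%N).
by apply: (@closed_preimage _ _ fst) => // x; exact: cvg_fst.
Qed.

Let precomp (g : nat -> nat) (p : Z * NN) : Z * NN := (p.1, fun j => p.2 (g j)).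

Let precomp_continuous (g : nat -> nat) : continuous (precomp g).
Proof.
move=> p.
have h : (fun p : Z * NN => (fun j => p.2 (g j)) : NN) @ p --> ((fun j => p.2 (g j)) : NN).
  apply/(@cvg_prod_topologyP nat (fun=> nat)) => i.
  have h1 : (fun p : Z * NN => p.2) @ p --> p.2 by exact: cvg_snd.
  exact: cvg_comp h1 (@proj_continuousT nat (fun=> nat) (g i) p.2).
have h1 : (fun p : Z * NN => p.1) @ p --> p.1 by exact: cvg_fst.
exact: cvg_pair h1 h.
Qed.

(** The first entry of the witness names a set of the union, and the shifted witness serves for that
    set. *)
Lemma souslin_bigcup (F : nat -> set Z) :
  (forall n, souslin (F n)) -> souslin (\bigcup_n F n).
Proof.
move=> /choice[K hK].
exists (\bigcap_m ((fun p : Z * NN => p.2 0%N) @^-1` [set i | i <> m] `|`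
  precomp S @^-1` K m)); split.
  apply: closed_bigI => m _; apply: closedU.
    apply: (@closed_preimage (Z * NN)%type nat); last exact: discrete_closed.
    move=> p; have h1 : (fun p : Z * NN => p.2) @ p --> p.2 by exact: cvg_snd.
    exact: cvg_comp h1 (@proj_continuousT nat (fun=> nat) 0%N p.2).
  apply: closed_preimage; last exact: (hK m).1.
  exact: precomp_continuous.
move=> z; split=> [[n _ /(hK n).2[f Kf]]|[f hf]].
  exists ((fun j => if j is k.+1 then f k else n) : NN).
  move=> m _ /=.
  by have [<-|/eqP nm] := eqVneq n m; [right; exact: Kf | left].
by have [//|/= Kf] := hf (f 0%N) I; exists (f 0%N) => //; apply/(hK _).2; eexists; exact: Kf.
Qed.

Lemma souslin_bigcap (F : nat -> set Z) :
  (forall n, souslin (F n)) -> souslin (\bigcap_n F n).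
Proof.
move=> /choice[K hK].
exists (\bigcap_i precomp (fun j => pickle (i, j)) @^-1` K i); split.
  apply: closed_bigI => i _; apply: closed_preimage; last exact: (hK i).1.
  exact: precomp_continuous.
move=> z; split=> [h|[f hf] i _]; last by apply/(hK _).2; eexists; exact: hf.
have /choice[f hf] i : exists f, K i (z, f) by apply/(hK i).2/h.
exists (fun n => if unpickle n is Some p then f p.1 p.2 else 0%N) => i _ /=.
rewrite /precomp /= (_ : (fun j => _) = f i) //; apply/funext => j; by rewrite pickleK.
Qed.

(** Treating [B] and its complement together makes the complement step of the induction trivial. *)
Lemma souslin_borel B :
  (forall U : set Z, open U -> exists2 F : nat -> set Z,
    forall n, closed (F n) & U = \bigcup_n F n) ->
  borel_set B -> souslin B.
Proof.
move=> hF hB; suff : souslin B /\ souslin (~` B) by case.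
move: B hB; apply: (@borel_ind _ (fun B => souslin B /\ souslin (~` B))) => [U oU|A []|F hFn].
- split; last exact/souslin_closed/open_closedC.
  by have [F cF ->] := hF U oU; apply: souslin_bigcup => n; apply: souslin_closed.
- by rewrite setCK.
- split; first by apply: souslin_bigcup => n; apply: (hFn n).1.
  by rewrite setC_bigcup; apply: souslin_bigcap => n; apply: (hFn n).2.
Qed.

End Souslin.

Lemma open_fsigma_square (R : realType) (X : topologicalType) (rho : X -> X -> R)
    (q : nat -> X) : is_metric rho -> induces_topology rho ->
  (forall x (e : R), 0 < e -> exists n, rho (q n) x < e) ->
  forall U : set (X * X), open U -> exists2 F : nat -> set (X * X),
    forall n, closed (F n) & U = \bigcup_n F n.
Proof.
move=> hm ht hq U oU; have [[_ rr sy tri] _] := hm.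
pose Q (p : nat * nat * nat) : set (X * X) :=
  fst @^-1` [set x | rho (q p.1.1) x <= p.2.+1%:R^-1] `&`
  snd @^-1` [set x | rho (q p.1.2) x <= p.2.+1%:R^-1].
exists (fun n => if unpickle n is Some p then
    if `[< Q p `<=` U >] then Q p else set0 else set0).
  move=> n; case: (unpickle n) => [p|]; last exact: closed0.
  case: asboolP => _; last exact: closed0.
  apply: closedI.
    apply: (@closed_preimage _ _ fst); last exact: (closed_metric_ball hm ht).
    by move=> z; exact: cvg_fst.
  apply: (@closed_preimage _ _ snd); last exact: (closed_metric_ball hm ht).
  by move=> z; exact: cvg_snd.
apply/seteqP; split=> [[x y] Uxy|z [n _]]; last first.
  by case: (unpickle n) => // p; case: asboolP => // h /h.
move: oU; rewrite openE => /(_ _ Uxy); rewrite /interior => -[[A B] /= []].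
move=> /(induces_nbhs hm ht)[a a0 aA] /(induces_nbhs hm ht)[b b0 bB] AB.
have c0 : 0 < Num.min a b / 2 by rewrite divr_gt0 // lt_min a0.
have [n] := ltr_add_invr c0; rewrite add0r => hn.
have n0 : 0 < n.+1%:R^-1 :> R by rewrite invr_gt0.
have [k hk] := hq x _ n0; have [l hl] := hq y _ n0.
exists (pickle (k, l, n)) => //; rewrite pickleK asboolT; first by split; apply: ltW.
have near2 (u v w : X) : rho u v < n.+1%:R^-1 -> rho u w <= n.+1%:R^-1 ->
    rho v w < Num.min a b.
  move=> uv uw; apply: le_lt_trans (tri _ u _) _; rewrite sy.
  rewrite [ltRHS]splitr ltrD //; first exact: lt_trans hn.
  exact: le_lt_trans hn.
move=> [v w] [/= hv hw]; apply: (AB (v, w)); split => /=.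
  by apply: aA => /=; have := near2 _ _ _ hk hv; rewrite lt_min => /andP[].
by apply: bB => /=; have := near2 _ _ _ hl hw; rewrite lt_min => /andP[].
Qed.

(** * The G_0 dichotomy *)

Lemma injective_nat_unbounded (f : nat -> nat) :
  injective f -> forall k, exists m, (k <= f m)%N.
Proof.
move=> fi k; apply: contrapT => /forallNP h.
have : (size (map f (iota 0 k.+1)) <= size (iota 0 k))%N.
  apply: uniq_leq_size; first by rewrite (map_inj_uniq fi) iota_uniq.
  move=> y /mapP[m _ ->]; rewrite mem_iota add0n ltnNge; apply/negP; exact: h.
by rewrite size_map !size_iota ltnn.
Qed.

(** The parameters of [G_0]: one word of each length, such that every word is an initial segment of
    one of them. Each word occurs in infinitely many codes [n], hence in one that is at least its
    length. *)
Definition dense_bits (n : nat) : seq bool :=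
  let t := if unpickle n is Some p then (p : seq bool * nat).1 else [::] in
  take n (t ++ nseq n false).

Lemma size_dense_bits n : size (dense_bits n) = n.
Proof. by rewrite size_takel // size_cat size_nseq leq_addl. Qed.

Lemma dense_bitsP (t : seq bool) : exists n r, dense_bits n = t ++ r.
Proof.
have [|m hm] := @injective_nat_unbounded (fun m => pickle (t, m)) _ (size t).
  by move=> a b /(pcan_inj pickleK)[].
set n := pickle (t, m) in hm.
exists n, (take (n - size t) (nseq n false)).
rewrite /dense_bits {1}/n pickleK take_cat ltnNge hm /=; congr (_ ++ _).
Qed.

Lemma mkseq_addn (T : Type) (x : nat -> T) n k :
  mkseq x (n + k) = mkseq x n ++ map x (iota n k).
Proof. by rewrite /mkseq iotaD map_cat. Qed.

Lemma mkseq_rcons (T : Type) (x : nat -> T) n :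
  mkseq x n.+1 = rcons (mkseq x n) (x n).
Proof. by rewrite -addn1 mkseq_addn /= cats1. Qed.

Section Chromatic.
Variables (X : Type) (G : X -> X -> Prop).

Definition independent (A : set X) := forall x y, A x -> A y -> ~ G x y.

(* No definability is required of the pieces. *)
Definition sigma_independent (A : set X) :=
  exists P : nat -> set X, (forall n, independent (P n)) /\ A `<=` \bigcup_n P n.

Lemma sigma_independent_bigcup (I : countType) (F : I -> set X) :
  (forall i, sigma_independent (F i)) -> sigma_independent (\bigcup_i F i).
Proof.
move=> /choice[P hP].
exists (fun n => if unpickle n is Some p then P p.1 p.2 else set0); split.
  by move=> n; case: (unpickle n) => [p|//]; exact: (hP p.1).1.
move=> x [i _ /(hP i).2[m _ Px]]; exists (pickle (i, m)) => //.
by rewrite pickleK.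
Qed.

Lemma sigma_independentU (A B : set X) :
  sigma_independent A -> sigma_independent B -> sigma_independent (A `|` B).
Proof.
move=> sA sB.
have := @sigma_independent_bigcup bool (fun b => if b then A else B).
move=> /(_ _)[|P [iP hP]]; first by case.
exists P; split => // x [Ax|Bx]; apply: hP; [by exists true | by exists false].
Qed.

(* A configuration labels the words of length n, the other values being junk.
   Working with large sets of configurations replaces the transfinite derivative
   of the usual proof of the [G_0] dichotomy. *)
Definition large (n : nat) (L : set (seq bool -> X)) :=
  forall A, sigma_independent A ->
    exists2 u, L u & forall t, size t = n -> ~ A (u t).

(** If no colour class were large, each would be blocked by a sigma-independent set, and the
    countable union of these would block [L]. *)
Lemma large_split (n : nat) (L : set (seq bool -> X)) (C : countType)
    (tau : (seq bool -> X) -> C) :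
  large n L -> exists a, large n (L `&` [set u | tau u = a]).
Proof.
move=> lL; apply: contrapT => /forallNP h.
have /choice[A hA] a : exists A, sigma_independent A /\
    forall u, L u -> tau u = a -> exists2 t, size t = n & A (u t).
  have := h a; rewrite /large -existsNP => -[A /not_implyP[sA nA]].
  exists A; split => // u Lu ua; apply: contrapT => nt; apply: nA.
  by exists u => // t st At; apply: nt; exists t.
have [u Lu uA] := lL _ (sigma_independent_bigcup (fun a => (hA a).1)).
have [t st At] := (hA (tau u)).2 u Lu erefl.
by apply: (uA t st); exists (tau u).
Qed.

(* The restrictions of the finite approximations of [G_0] to the words ending in
   0 and in 1 are joined by a single edge, the one between the two extensions of
   [dense_bits n]. *)
Definition glue (n : nat) (L : set (seq bool -> X)) : set (seq bool -> X) :=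
  [set u | exists u0 u1, [/\ L u0, L u1, G (u0 (dense_bits n)) (u1 (dense_bits n)) &
    forall t, size t = n -> u (rcons t false) = u0 t /\ u (rcons t true) = u1 t]].

(** Let [W] be the set of values at [dense_bits n] of the members of [L] avoiding [A]. If [W]
    contained no edge, the union of [A] and [W] would be sigma-independent, and a member of [L]
    avoiding it would have its own value at [dense_bits n] in [W]. *)
Lemma large_glue n L : large n L -> large n.+1 (glue n L).
Proof.
move=> lL A sA.
pose good u := L u /\ forall t, size t = n -> ~ A (u t).
pose W : set X := [set x | exists2 u, good u & u (dense_bits n) = x].
have [u0 [u1 [g0 g1 Guv]]] : exists u0 u1, [/\ good u0, good u1 &
    G (u0 (dense_bits n)) (u1 (dense_bits n))].
  apply: contrapT => h.
  have iW : independent W.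
    move=> _ _ [u gu <-] [v gv <-] Guv; apply: h; by exists u, v.
  have sW : sigma_independent W by exists (fun=> W); split => // x Wx; exists 0%N.
  have [u Lu uA] := lL _ (sigma_independentU sA sW).
  apply: (uA _ (size_dense_bits n)).
  right; exists u => //; split => // t st At; exact: (uA t st (or_introl At)).
pose u t := if last false t then u1 (take n t) else u0 (take n t).
have uE t b : size t = n -> u (rcons t b) = if b then u1 t else u0 t.
  by move=> st; rewrite /u last_rcons -cats1 take_cat st ltnn subnn take0 cats0.
exists u.
  exists u0, u1; split => //; [exact: g0.1 | exact: g1.1|].
  by move=> t st; rewrite !uE.
case/lastP => // t b; rewrite size_rcons => -[st]; rewrite uE //.
by case: b; [exact: g1.2 | exact: g0.2].
Qed.

Hypothesis nG : ~ sigma_independent setT.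

Lemma large0 : large 0 setT.
Proof.
move=> A [P [iP AP]]; have [x nAx] : exists x, ~ A x.
  apply: contrapT => /forallNP h; apply: nG; exists P; split => // x _.
  by apply: AP; apply: contrapT; exact: h.
by exists (fun=> x).
Qed.

Variable tau : forall n : nat, (seq bool -> X) -> seq (nat * nat).

(** Gluing and splitting alternate: stage [n+1] is a large part of the gluing of stage [n] on which
    the code is constant. Largeness against the empty set gives a member of each stage. *)
Lemma large_sequence : exists M : nat -> set (seq bool -> X),
  [/\ forall n, exists u, M n u,
      forall n u v, M n u -> M n v -> tau n u = tau n v &
      forall n u, M n.+1 u -> glue n (M n) u].
Proof.
have /choice[pick hpick] (p : nat * set (seq bool -> X)) : exists L',
    large p.1 p.2 -> [/\ large p.1 L', L' `<=` p.2 &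
      forall u v, L' u -> L' v -> tau p.1 u = tau p.1 v].
  case: p => n L /=; have [lL|nl] := pselect (large n L); last by exists set0 => /nl.
  have [a la] := large_split (tau n) lL.
  exists (L `&` [set u | tau n u = a]) => _; split; [exact: la | by move=> u [] |].
  by move=> u v [_ /= ->] [_ /= ->].
pose M := fix M n := if n is m.+1 then pick (n, glue m (M m)) else pick (0%N, setT).
have lM n : large n (M n).
  elim: n => [|n IH]; first by have [] := hpick (0%N, setT) large0.
  by have [] := hpick (n.+1, glue n (M n)) (large_glue IH).
exists M; split.
- move=> n; have [|u Mu _] := lM n set0; last by exists u.
  by exists (fun=> set0); split => // _ x y [].
- case=> [|n]; first by have [] := hpick (0%N, setT) large0.
  by have [] := hpick (n.+1, glue n (M n)) (large_glue (lM n)).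
- move=> n u; have [_ + _] := hpick (n.+1, glue n (M n)) (large_glue (lM n)).
  exact.
Qed.

(** Each letter of [r], read from the end, picks one of the two configurations that were glued, so a
    fixed tail leads back to stage [n]. *)
Lemma glue_restrict (M : nat -> set (seq bool -> X)) :
  (forall n u, M n.+1 u -> glue n (M n) u) ->
  forall n r u, M (n + size r)%N u ->
    exists2 v, M n v & forall t, size t = n -> u (t ++ r) = v t.
Proof.
move=> hM n; elim/last_ind => [|r b IH] u.
  by rewrite addn0 => Mu; exists u => // t _; rewrite cats0.
rewrite size_rcons addnS => /hM[u0 [u1 [M0 M1 _ uE]]].
have [v Mv vE] := IH (if b then u1 else u0) ltac:(by case: (b)).
exists v => // t st; rewrite -rcons_cat -vE //.
have [e0 e1] := uE (t ++ r) ltac:(by rewrite size_cat st).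
by case: (b).
Qed.

End Chromatic.

(** The point [phi x] is the limit of the labels of the initial segments of [x]. An edge survives
    the limit because its Souslin witnesses converge as well and [K] is closed. *)
Theorem G0_homomorphism (R : realType) (X : topologicalType) (G : X -> X -> Prop) :
  polish R X -> souslin [set p : X * X | G p.1 p.2] ->
  ~ sigma_independent G setT ->
  exists phi : {ptws nat -> bool} -> X, continuous phi /\
    forall n (x y : {ptws nat -> bool}), mkseq x n = dense_bits n ->
      mkseq y n = dense_bits n -> x n = false -> y n = true ->
      (forall j, (n < j)%N -> x j = y j) -> G (phi x) (phi y).
Proof.
move=> /polish_metric[rho [q [hm ht hc hq]]] [K [cK KG]] nG.
have [[rp rr sy tri] r0] := hm.
have inv_gt0 j : 0 < j.+1%:R^-1 :> R by rewrite invr_gt0.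
have /choice[c hcode] x : exists c : nat -> nat, forall j, rho (q (c j)) x < j.+1%:R^-1.
  by have /choice[c h] j := hq x _ (inv_gt0 j); exists c.
have /choice[w hw] (p : X * X) : exists f : {ptws nat -> nat}, G p.1 p.2 -> K (p, f).
  have [Gp|nGp] := pselect (G p.1 p.2); last by exists (fun=> 0%N).
  by have [f Kf] := (KG p).1 Gp; exists f.
(* Fixing [tau n] at stage n makes the limits of the points and of the Souslin
   witnesses of the edges exist. *)
pose tau n (u : seq bool -> X) := [seq (c (u (d.1.1 : n.-tuple bool)) n,
  w (u (d.1.1 : n.-tuple bool), u (d.1.2 : n.-tuple bool)) (d.2 : 'I_n.+1)) |
  d <- enum {: n.-tuple bool * n.-tuple bool * 'I_n.+1}].
have tauE n u v : tau n u = tau n v -> forall t t' j, size t = n -> size t' = n ->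
    (j <= n)%N -> c (u t) n = c (v t) n /\ w (u t, u t') j = w (v t, v t') j.
  move=> /eq_in_map h t t' j /eqP st /eqP st' jn.
  have := h (Tuple st, Tuple st', Ordinal (jn : (j < n.+1)%N)).
  by rewrite mem_enum => /(_ isT) /= [].
have [M [Mne Mtau Mglue]] := large_sequence nG tau.
have [uu Muu] := choice Mne.
have Mrestr := glue_restrict Mglue.
(* The members [uu n] of different stages are chosen independently. They are linked through
   restriction: [uu m] read along a fixed tail is a member of stage [n], so it has the same code as
   [uu n]. *)
pose pt (x : nat -> bool) n := uu n (mkseq x n).
have ptc x n m : (n <= m)%N -> rho (q (c (pt x n) n)) (pt x m) < n.+1%:R^-1.
  move=> nm; pose r := map x (iota n (m - n)).
  have sr : (n + size r)%N = m by rewrite size_map size_iota subnKC.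
  have [|v Mv vE] := Mrestr n r (uu m); first by rewrite sr; exact: Muu.
  have -> : pt x m = v (mkseq x n).
    by rewrite -vE ?size_mkseq // /pt -{2}(subnKC nm) mkseq_addn.
  have [-> _] := tauE n _ _ (Mtau n _ _ (Muu n) Mv) (mkseq x n) (mkseq x n) 0%N
    (size_mkseq _ _) (size_mkseq _ _) (leq0n _).
  exact: hcode.
have small e : 0 < e -> exists n, n.+1%:R^-1 + n.+1%:R^-1 < e :> R.
  move=> e0; have e2 : 0 < e / 2 by rewrite divr_gt0.
  have [n] := ltr_add_invr e2; rewrite add0r => hn; exists n.
  by rewrite [ltRHS]splitr ltrD.
have /choice[phi hphi] x : exists l, (fun n => rho (pt x n) l) @ \oo --> (0 : R).
  apply: hc => e /small[N hN].
  exists ([set m | (N <= m)%N], [set m | (N <= m)%N]) => /=.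
    by split; exists N.
  move=> [m n] /= [Nm Nn]; apply: le_lt_trans (tri _ (q (c (pt x N) N)) _) _.
  apply: lt_trans _ hN; rewrite sy ltrD //; exact: ptc.
have phi_bound x n : rho (q (c (pt x n) n)) (phi x) <= n.+1%:R^-1.
  apply/ler_addgt0Pr => e e0.
  have /cvgrPdist_lt/(_ e e0)[N _ hN] := hphi x.
  have /= := hN (maxn N n) (leq_maxl _ _); rewrite sub0r normrN ger0_norm // => h.
  apply: le_trans (tri _ (pt x (maxn N n)) _) _; apply: lerD; last exact: ltW.
  by apply/ltW/ptc; rewrite leq_maxr.
exists phi; split.
  move=> x A /(induces_nbhs hm ht)[e /small[N hN] eA].
  have : nbhs x [set y : {ptws nat -> bool} | agree N x y] by exact: nbhs_agree.
  apply: filterS => y xy; apply: eA => /=.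
  apply: le_lt_trans (tri _ (q (c (pt x N) N)) _) _.
  apply: le_lt_trans _ hN; rewrite sy lerD //.
  have -> : pt x N = pt y N; last exact: phi_bound.
  rewrite /pt; congr (uu N _); apply/eq_in_map => i; rewrite mem_iota => /andP[_].
  by rewrite add0n => iN; apply: xy.
move=> k x y xk yk xkF ykT xy.
(* The two points share their tail beyond [k], so restriction leads to stage [k+1], where the gluing
   put an edge between the two extensions of [dense_bits k]. *)
have edge m : (k < m)%N -> forall u, M m u -> G (u (mkseq x m)) (u (mkseq y m)).
  move=> km u Mu; pose r := map x (iota k.+1 (m - k.+1)).
  have ry : r = map y (iota k.+1 (m - k.+1)).
    by apply/eq_in_map => i; rewrite mem_iota => /andP[ki _]; apply: xy.
  have sr : (k.+1 + size r)%N = m by rewrite size_map size_iota subnKC.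
  have [|v Mv vE] := Mrestr k.+1 r u; first by rewrite sr.
  have [u0 [u1 [_ _ Guv uvE]]] := Mglue _ _ Mv.
  rewrite -{1}(subnKC km) -{1}[in mkseq y m](subnKC km) !mkseq_addn -ry -/r.
  rewrite !vE ?size_mkseq // !mkseq_rcons xk yk xkF ykT.
  have [-> _] := uvE _ (size_dense_bits k).
  by have [_ ->] := uvE _ (size_dense_bits k).
pose f j := w (pt x (maxn k.+1 j), pt y (maxn k.+1 j)) j.
have wE j m : (maxn k.+1 j <= m)%N -> w (pt x m, pt y m) j = f j.
  move=> nm; set n := maxn k.+1 j in nm *; have kn : (k < n)%N by rewrite leq_maxl.
  pose r := map x (iota n (m - n)).
  have ry : r = map y (iota n (m - n)).
    apply/eq_in_map => i; rewrite mem_iota => /andP[ki _]; apply: xy.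
    exact: leq_trans ki.
  have sr : (n + size r)%N = m by rewrite size_map size_iota subnKC.
  have [|v Mv vE] := Mrestr n r (uu m); first by rewrite sr; exact: Muu.
  rewrite /pt -{2 4}(subnKC nm) !mkseq_addn -ry -/r !vE ?size_mkseq //.
  have [_ e] := tauE n _ _ (Mtau n _ _ (Muu n) Mv) (mkseq x n) (mkseq y n) j
    (size_mkseq _ _) (size_mkseq _ _) (leq_maxr _ _).
  exact: esym e.
apply/(KG (phi x, phi y)); exists f.
have cvgpt z : pt z @ \oo --> phi z by apply: (induces_cvg hm ht); exact: hphi.
have cvgw : (fun n => w (pt x n, pt y n)) @ \oo --> (f : {ptws nat -> nat}).
  apply/(@cvg_prod_topologyP nat (fun=> nat)) => j A /nbhs_singleton Af.
  by exists (maxn k.+1 j) => // m /= hmj; rewrite wE.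
have cvgall : (fun n => ((pt x n, pt y n), w (pt x n, pt y n))) @ \oo -->
    ((phi x, phi y), (f : {ptws nat -> nat})).
  exact: cvg_pair (cvg_pair (cvgpt x) (cvgpt y)) cvgw.
apply: (closed_cvg K cK _ _ cvgall).
by exists k.+1 => // m /= km; apply: hw; exact: (edge m km (uu m)).
Qed.

(** * Perfect sets of separated points *)

Lemma continuous_agree (I J : countType) (D E : discreteTopologicalType)
    (f : {ptws I -> D} -> {ptws J -> E}) :
  (forall x l, exists m, forall y, agree m x y -> agree l (f x) (f y)) -> continuous f.
Proof.
move=> h x A /nbhs_agreeP[l lA]; have [m hm] := h x l.
by apply/nbhs_agreeP; exists m => y /hm; exact: lA.
Qed.

Lemma countable_base_cantor (I : countType) : exists B, @countable_base {ptws I -> bool} B.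
Proof.
eexists; apply: countable_base_ptws.
by apply: (@countable_base_discrete bool odd) => -[]; [exists 1%N | exists 0%N].
Qed.

Section Mycielski.
Variables (D : nat -> set (cantor * cantor)).
Hypothesis oD : forall n, open (D n) /\ dense (D n).

(** The requirements in [Q] are met one at a time. Since [r] and [s] differ, their cylinders can be
    shrunk independently to a box inside [D i], and further shrinking preserves the requirements
    already met. *)
Lemma mycielski_refine (Q : seq (seq bool * seq bool * nat)) (t : seq bool -> cantor) l :
  (forall p, p \in Q -> p.1.1 != p.1.2) ->
  exists t' l', [/\ (l <= l')%N, forall s, agree l (t s) (t' s) &
    forall p, p \in Q -> forall a b, agree l' (t' p.1.1) a -> agree l' (t' p.1.2) b ->
      D p.2 (a, b)].
Proof.
elim: Q => [_|[[r s] i] Q IH hQ]; first by exists t, l; split.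
have [|t1 [l1 [ll1 tt1 h1]]] := IH; first by move=> p pQ; apply: hQ; rewrite inE pQ orbT.
have rs : r != s by apply: (hQ (r, s, i)); rewrite inE eqxx.
have [on dn] := oD i.
have [||[a b] [[/= ra sb] Dab]] := dn ([set x | agree l1 (t1 r) x] `*` [set x | agree l1 (t1 s) x]).
- by exists (t1 r, t1 s); split; exact: agree_refl.
- rewrite openE => -[x y] [/= rx sy].
  exists ([set x | agree l1 (t1 r) x], [set x | agree l1 (t1 s) x]) => //=.
  by split; apply: open_nbhs_nbhs; split => //; exact: open_agree.
have : nbhs (a, b) (D i) by apply: open_nbhs_nbhs.
case=> -[A B] /= [/nbhs_agreeP[la hA] /nbhs_agreeP[lb hB]] AB.
pose t2 x := if x == r then a else if x == s then b else t1 x.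
have t12 x : agree l1 (t1 x) (t2 x).
  by rewrite /t2; case: eqP => [->//|_]; case: eqP => [->//|_]; exact: agree_refl.
exists t2, (maxn l1 (maxn la lb)); split.
- by rewrite leq_max ll1.
- by move=> x; apply: agree_trans (tt1 x) _; apply: agree_le (t12 x).
move=> p; rewrite inE => /orP[/eqP-> /=|pQ] x y.
  rewrite /t2 eqxx eq_sym (negbTE rs) eqxx => ax bY; apply: (AB (x, y)); split => /=.
    by apply: hA; apply: agree_le ax; rewrite !leq_max leqnn orbT.
  by apply: hB; apply: agree_le bY; rewrite !leq_max leqnn !orbT.
move=> px py; apply: h1 => //.
  by apply: agree_trans (t12 _) _; apply: agree_le px; rewrite leq_maxl.
by apply: agree_trans (t12 _) _; apply: agree_le py; rewrite leq_maxl.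
Qed.

End Mycielski.

(** Stage [n] attaches a cylinder to every word of length [n], so that distinct words span a box
    inside [D i] for each [i < n]. Two points that differ at [p] have distinct words of every length
    above [p], hence their images form a pair in every [D i]. *)
Lemma mycielski (C : set (cantor * cantor)) : comeager C ->
  exists2 psi : cantor -> cantor, continuous psi &
    forall x y, x <> y -> C (psi x, psi y).
Proof.
move=> [D [oD DC]].
pose words n : seq (seq bool) := [seq tval t | t <- enum {: n.-tuple bool}].
have wordsP n s : size s = n -> s \in words n.
  by move=> /eqP ss; apply/mapP; exists (Tuple ss); rewrite ?mem_enum.
pose Q n : seq (seq bool * seq bool * nat) :=
  [seq p <- [seq (p, i) | p <- [seq (r, s) | r <- words n, s <- words n],
     i <- iota 0 n] | p.1.1 != p.1.2].
have QP n r s i : size r = n -> size s = n -> (i < n)%N -> r != s -> (r, s, i) \in Q n.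
  move=> hr hs hi rs; rewrite mem_filter rs /=; apply/allpairsP.
  exists ((r, s), i); rewrite mem_iota hi; split => //=.
  by apply/allpairsP; exists (r, s); rewrite !wordsP.
have step (p : nat * ((seq bool -> cantor) * nat)) : exists q : (seq bool -> cantor) * nat,
    [/\ (p.2.2 < q.2)%N,
      forall s b, size s = p.1 -> agree p.2.2 (p.2.1 s) (q.1 (rcons s b)) &
      forall z, z \in Q p.1.+1 -> forall a b, agree q.2 (q.1 z.1.1) a ->
        agree q.2 (q.1 z.1.2) b -> D z.2 (a, b)].
  case: p => n [t l] /=.
  have [|t' [l' [ll' tt' h]]] := mycielski_refine oD (Q := Q n.+1) (fun s => t (take n s)) l.+1.
    by move=> p; rewrite mem_filter => /andP[].
  exists (t', l'); split => //= s b ss.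
  have := tt' (rcons s b); rewrite -cats1 take_cat ss ltnn subnn take0 cats0.
  exact: agree_le.
have [f hf] := choice step.
pose u := fix u n := if n is m.+1 then f (m, u m) else (fun=> point : cantor, 0%N).
have hu (x : cantor) n : (((u n).2 < (u n.+1).2)%N /\
    agree (u n).2 ((u n).1 (mkseq x n)) ((u n.+1).1 (mkseq x n.+1))).
  have [h1 h2 _] := hf (n, u n); split => //.
  by rewrite mkseq_rcons; apply: h2; rewrite size_mkseq.
have /choice[psi hpsi] x := agree_lim (hu x).
have un n : (n <= (u n).2)%N.
  by elim: n => // n IH; apply: leq_ltn_trans IH _; have [] := hf (n, u n).
exists psi.
  apply: continuous_agree => x l; exists l => y xy.
  have e : mkseq x l = mkseq y l.
    by apply/eq_in_map => i; rewrite mem_iota => /andP[_]; rewrite add0n => /xy.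
  apply: (agree_le (un l)); apply: agree_trans (agree_sym (hpsi x l)) _.
  by rewrite e; exact: hpsi.
move=> x y xy; apply: DC => i _.
have [p xyp] : exists p, x p <> y p.
  by apply: contrapT => /forallNP h; apply: xy; apply/funext => p; apply: contrapT => /h.
pose n := maxn p i; have [_ _ h] := hf (n, u n).
apply: (h (mkseq x n.+1, mkseq y n.+1, i)); last 2 first.
- exact: (hpsi x n.+1).
- exact: (hpsi y n.+1).
apply: QP; rewrite ?size_mkseq // ?ltnS ?leq_maxr //.
apply/eqP => /eq_in_map e; apply: xyp; apply: e.
by rewrite mem_iota add0n ltnS leq_maxl.
Qed.

(** Distances inside an independent piece are below [c], so one point from each nonempty piece gives
    the countable set required. *)
Lemma not_separable_sigma_independent (R : realType) (X : Type) (x0 : X)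
    (d : X -> X -> R) c :
  sigma_independent (fun x y => c <= d x y) setT -> delta_separable d c.
Proof.
move=> [P [iP hP]].
have /choice[s hs] n : exists s, P n !=set0 -> P n s.
  by have [[s Ps]|nP] := pselect (P n !=set0); [exists s | exists x0 => /nP].
exists (range s); first exact: card_image_le.
move=> x; have [n _ Px] := hP x I; exists (s n); first by exists n.
rewrite ltNge; apply/negP; apply: (iP n) => //; apply: hs; by exists x.
Qed.

(** If the pairs with [d < c / 2] were not meager, the section at some [x] would be comeager in an
    open set. Both ends of a [G_0] edge could then be found in it, at distance below [c] from each
    other by the triangle inequality through [phi x]; this is where [c] is halved. *)
Theorem perfect_separated (R : realType) (X : topologicalType) (d : X -> X -> R) (c : R) :
  polish R X -> borel_pseudometric d -> ~ delta_separable d c ->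
  exists2 theta : cantor -> X, continuous theta &
    forall x y, x <> y -> c / 2 <= d (theta x) (theta y).
Proof.
move=> pX [[d0 dr ds dt] bd] nsep.
have [[x0 _] _ _] := pX.
have [rho [q [hm ht _ hq]]] := polish_metric pX.
have bG : borel_set [set p : X * X | c <= d p.1 p.2].
  have -> : [set p : X * X | c <= d p.1 p.2] = ~` [set p | d p.1 p.2 < c].
    by apply/seteqP; split=> p /=; rewrite leNgt => /negP.
  by apply: borel_setC; exact: borel_lt.
have sG := souslin_borel (open_fsigma_square hm ht hq) bG.
have nG : ~ sigma_independent (fun x y => c <= d x y) setT.
  by move=> /(not_separable_sigma_independent x0).
have [phi [cphi hphi]] := G0_homomorphism pX sG nG.
pose F : set (cantor * cantor) := [set p | d (phi p.1) (phi p.2) < c / 2].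
have bF : borel_set F.
  apply: (@borel_lt R _ (fun p : cantor * cantor => d (phi p.1) (phi p.2))).
  apply: (@borel_fun_comp _ _ _ (fun p : cantor * cantor => (phi p.1, phi p.2))
    (fun p => d p.1 p.2)) => //.
  apply: borel_fun_continuous => p.
  have h1 : (fun p : cantor * cantor => phi p.1) @ p --> phi p.1.
    apply: (@cvg_comp _ _ _ (fun p : cantor * cantor => p.1) phi _ (nbhs p.1)); last exact: cphi.
    exact: cvg_fst.
  have h2 : (fun p : cantor * cantor => phi p.2) @ p --> phi p.2.
    apply: (@cvg_comp _ _ _ (fun p : cantor * cantor => p.2) phi _ (nbhs p.2)); last exact: cphi.
    exact: cvg_snd.
  exact: cvg_pair h1 h2.
have [U [oU cU]] := baire_property_borel bF.
suff U0 : forall p, ~ U p.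
  have [psi cpsi hpsi] := mycielski cU.
  exists (phi \o psi); first by move=> x; apply: continuous_comp; [exact: cpsi | exact: cphi].
  move=> x y /hpsi /= hF; rewrite leNgt; apply/negP => /hF; exact: U0.
move=> [x0' y0] Uxy.
have [B hB] := countable_base_cantor nat.
have cs := comeager_sections hB cU.
have [[V W] /= [Vx /nbhs_agreeP[l lW]] VW] : nbhs (x0', y0) U by apply: open_nbhs_nbhs.
have [||x [Vx' cx]] := baire_space_ptws cs (O := V°).
- by exists x0'.
- exact: open_interior.
have [n [r nr]] := dense_bitsP (mkseq y0 l).
(* Flipping bit [n] is a homeomorphism, so for generic [y] both [y] and [h y] are generic for the
   section at [x]; after the word [dense_bits n] they form an edge. *)
pose h (y : cantor) : cantor := fun j => if j == n then ~~ y j else y j.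
have hK y : h (h y) = y by apply/funext => j; rewrite /h; case: eqP => // _; exact: negbK.
have ch : continuous h.
  by apply: continuous_agree => y m; exists m => z yz j jm; rewrite /h yz.
have oh A : open A -> open (h @` A).
  move=> oA; have -> : h @` A = h @^-1` A.
    apply/seteqP; split=> [_ [y Ay <-]|y Ay] /=; first by rewrite hK.
    by exists (h y) => //; exact: hK.
  by apply: open_comp => // y _; exact: ch.
have cc := comeagerI cx (comeager_preimage ch oh cx).
pose z : cantor := fun j => if (j < n)%N then nth false (dense_bits n) j else false.
have [||y [zy /= [Fy Fhy]]] := baire_space_ptws cc (O := [set y | agree n.+1 z y]).
- by exists z; exact: agree_refl.
- exact: open_agree.
have yn : mkseq y n = dense_bits n.
  apply: (@eq_from_nth _ false); rewrite size_mkseq ?size_dense_bits // => i iN.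
  by rewrite nth_mkseq // -zy /z ?iN // ltnW.
have hyn : mkseq (h y) n = dense_bits n.
  rewrite -yn; apply/eq_in_map => i; rewrite mem_iota => /andP[_]; rewrite add0n => iN.
  by rewrite /h ltn_eqF.
have yF : y n = false by rewrite -zy ?ltnSn // /z ltnn.
have ln : (l <= n)%N.
  by rewrite -(size_dense_bits n) nr size_cat size_mkseq leq_addr.
have Wy v : mkseq v n = dense_bits n -> W v.
  move=> vn; apply: lW => p pl.
  have pn : (p < n)%N := leq_trans pl ln.
  have := congr1 (fun s => nth false s p) vn.
  by rewrite nr nth_mkseq // nth_cat size_mkseq pl nth_mkseq // => ->.
have edge : c <= d (phi y) (phi (h y)).
  apply: (hphi n) => //; first by rewrite /h eqxx yF.
  by move=> j nj; rewrite /h gtn_eqF.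
have F1 : F (x, y) by apply/Fy/VW; split; [exact: interior_subset | exact: Wy].
have F2 : F (x, h y) by apply/Fhy/VW; split; [exact: interior_subset | exact: Wy].
have := dt (phi y) (phi x) (phi (h y)); rewrite [d (phi y) (phi x)]ds.
by move: F1 F2 edge; rewrite /F /=; lra.
Qed.

(** * E_1 does not reduce to R^N/c_0 *)

(** On one comeager set all the [B i] are relatively open. Applied to preimages of basic open sets,
    this replaces continuity of a Borel map. *)
Lemma baire_property_family (T : topologicalType) (I : countType) (B : I -> set T) :
  (forall i, borel_set (B i)) ->
  exists U : I -> set T, (forall i, open (U i)) /\
    comeager [set x | forall i, B i x <-> U i x].
Proof.
move=> /(_ _)/baire_property_borel hB; have [U hU] := choice hB.
exists U; split=> [i|]; first exact: (hU i).1.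
by apply: comeagerS (comeager_bigcap (fun i => (hU i).2)) => x h i; exact: h.
Qed.

Section Row_replacement.
Local Notation T := {ptws nat * nat -> bool}.

Definition set_row (k : nat) (x : T) (z : cantor) : T :=
  fun p => if p.1 == k then z p.2 else x p.

Lemma set_row_continuous k : continuous (fun p : T * cantor => set_row k p.1 p.2).
Proof.
apply: continuous_prod_topology => i [x z]; rewrite /set_row /=.
case: eqP => _.
  apply: (@cvg_comp _ _ _ (fun p : T * cantor => p.2) (fun z : cantor => z i.2) _ (nbhs z)).
    exact: cvg_snd.
  exact: (@proj_continuousT nat (fun=> bool)).
apply: (@cvg_comp _ _ _ (fun p : T * cantor => p.1) (fun x : T => x i) _ (nbhs x)).
  exact: cvg_fst.
exact: (@proj_continuousT (nat * nat)%type (fun=> bool)).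
Qed.

Lemma set_row_cst_continuous k z : continuous (fun x => set_row k x z).
Proof.
move=> x; have h : (fun x : T => (x, z)) @ x --> (x, z).
  have h1 : (fun x : T => x) @ x --> x by exact: cvg_id.
  have h2 : (fun _ : T => z) @ x --> z by exact: cvg_cst.
  exact: cvg_pair h1 h2.
exact: cvg_comp h (@set_row_continuous k (x, z)).
Qed.

Lemma set_row_continuousr k x : continuous (set_row k x).
Proof.
move=> z; have h : (fun z : cantor => (x, z)) @ z --> (x, z).
  have h1 : (fun _ : cantor => x) @ z --> x by exact: cvg_cst.
  have h2 : (fun z : cantor => z) @ z --> z by exact: cvg_id.
  exact: cvg_pair h1 h2.
exact: cvg_comp h (@set_row_continuous k (x, z)).
Qed.

Lemma set_row_id k x : set_row k x (fun j => x (k, j)) = x.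
Proof. by apply/funext => -[i j]; rewrite /set_row /=; case: eqP => // ->. Qed.

(** A point near [set_row k x z] comes from its own row [k] and from its other rows completed by row
    [k] of [x]. *)
Lemma set_row_open k (A : set (T * cantor)) :
  open A -> open ((fun p => set_row k p.1 p.2) @` A).
Proof.
move=> oA; rewrite openE => _ [[x z] Axz <-] /=.
have [[V W] /= [/nbhs_agreeP[l lV] /nbhs_agreeP[m mW]] VW] : nbhs (x, z) A.
  exact: open_nbhs_nbhs.
apply/nbhs_agreeP.
exists (maxn l (\max_(j < m) (pickle (k, nat_of_ord j)).+1)) => w /= hw.
exists (fun p => if p.1 == k then x p else w p, fun j => w (k, j)); last first.
  by apply/funext => -[i j]; rewrite /set_row /=; case: eqP => // ->.
apply: VW; split => /=.
  apply: lV => p pl; case: eqP => // pk; rewrite -hw; last by rewrite leq_max pl.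
  by rewrite /set_row; case: eqP.
apply: mW => j jm; rewrite -hw /set_row /= ?eqxx // leq_max; apply/orP; right.
exact: (leq_bigmax (Ordinal (jm : (j < m)%N))).
Qed.

Lemma comeager_set_row k (C : set T) : comeager C ->
  comeager [set x | comeager [set z | C (set_row k x z)]].
Proof.
have [B hB] := countable_base_cantor nat.
move=> cC; have := comeager_preimage (@set_row_continuous k) (@set_row_open k) cC.
exact: (comeager_sections hB).
Qed.

(** Passing to the points whose generic row replacements stay in the set is iterated, and the
    intersection of all iterates is stable under this operation. *)
Lemma comeager_row_closed (C : set T) : comeager C -> exists C', [/\ comeager C', C' `<=` C &
  forall x, C' x -> forall k, comeager [set z | C' (set_row k x z)]].
Proof.
move=> cC.
pose next C := C `&` \bigcap_k [set x : T | comeager [set z | C (set_row k x z)]].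
have cn n : comeager (iter n next C).
  elim: n => //= n IH; apply: comeagerI => //; apply: comeager_bigcap => k.
  exact: comeager_set_row.
exists (\bigcap_n iter n next C); split.
- exact: comeager_bigcap.
- by move=> x /(_ 0%N I).
move=> x hx k; apply: comeagerS (comeager_bigcap (I := nat) _); last first.
  by move=> n; have [_ /(_ k I)] := hx n.+1 I; exact.
by move=> z hz n _; exact: hz.
Qed.

End Row_replacement.

Lemma rat_approx (R : realType) (x e : R) : 0 < e -> exists q : rat, `|x - ratr q| < e.
Proof.
move=> e0.
have /dense_rat : ball x e !=set0 by exists x; apply: ballxx.
move=> /(_ (ball_open x _))[z [+ [q _ qz]]]; rewrite -{}qz => bq.
by exists q; move: bq; rewrite -ball_normE.
Qed.

Lemma half_expr_lt (R : realType) (e : R) : 0 < e -> exists n, 2^-1 ^+ n < e.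
Proof.
move=> e0; have [n] := ltr_add_invr e0; rewrite add0r => hn; exists n.+1.
apply: le_lt_trans hn.
by rewrite exprVn lef_pV2 ?posrE ?exprn_gt0 // -natrX ler_nat ltnW // ltn_expl.
Qed.

Section E1_not_c0.
Variable R : realType.
Local Notation T := {ptws nat * nat -> bool}.

Let row0 : cantor := fun=> false.

(* Rational finitely supported sequences are dense in [c_0], so these sets cover
   the space for each [i.1]. *)
Let A (theta : T -> {ptws nat -> R}) (i : nat * nat * seq rat) : set T :=
  [set x | forall j, `|theta x j - theta (set_row i.1.1 x row0) j - ratr (nth 0 i.2 j)|
     <= 2^-1 ^+ i.1.2].

Let borel_A theta i : borel_fun theta -> borel_set (A theta i).
Proof.
move=> bt; case: i => -[k m] s.
have bj j : borel_fun (fun x => theta x j).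
  apply: (@borel_fun_comp _ _ _ theta (fun y : {ptws nat -> R} => y j)) => //.
  by apply: borel_fun_continuous; exact: (@proj_continuousT nat (fun=> R)).
have bk j : borel_fun (fun x => theta (set_row k x row0) j).
  apply: (@borel_fun_comp _ _ _ (fun x => set_row k x row0) (fun x => theta x j)) => //.
  by apply: borel_fun_continuous; exact: set_row_cst_continuous.
have -> : A theta (k, m, s) = \bigcap_j
    ([set x | theta x j - theta (set_row k x row0) j - ratr (nth 0 s j) <= 2^-1 ^+ m] `&`
     [set x | ratr (nth 0 s j) - (theta x j - theta (set_row k x row0) j) <= 2^-1 ^+ m]).
  apply/seteqP; split=> x /= h j; last have [h1 h2] := h j I.
    move=> _; have := h j; rewrite ler_norml => /andP[h1 h2].
    by split=> //=; lra.
  by rewrite ler_norml; apply/andP; split => //; move: h1 h2 => /=; lra.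
apply: borel_bigcap => j; apply: borel_setI; apply: borel_le.
  by apply: borel_funB; [exact: borel_funB | exact: borel_fun_cst].
by apply: borel_funB; [exact: borel_fun_cst | exact: borel_funB].
Qed.

(** Row [n] is changed at step [n]. Zeroing it moves the image by an element of [c_0], so the point
    lies in some [A theta i]. This set is relatively open on a comeager set, so a generic nearby row
    stays in it and moves the image by at most [2 * 2^-n]. The limit [y] differs from [x0] in every
    row, yet its image is equivalent to that of [x0]. *)
Theorem E1_not_reducible_c0 : ~ borel_reducible E_1 (@RN_c0 R).
Proof.
move=> [theta bt red].
have half_gt0 n : 0 < 2^-1 ^+ n :> R by rewrite exprn_gt0.
have [U [oU cU]] := baire_property_family (fun i => borel_A i bt).
pose V (i : nat * nat) := [set x | @rat_ball R i.2 (theta x i.1)].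
have bV i : borel_set (V i).
  apply: (bt [set y | @rat_ball R i.2 (y i.1)]); apply: borel_open.
  apply: (@open_comp _ _ (fun y : {ptws nat -> R} => y i.1)); last exact: (countable_base_real R).1.
  by move=> y _; exact: (@proj_continuousT nat (fun=> R)).
have [OV [oOV cO]] := baire_property_family bV.
have [D [oD DC]] := comeagerI cU cO.
have cD : comeager (\bigcap_n D n).
  by exists D; split; [exact: oD | exact: subset_refl].
have [K [cK KD rowC]] := comeager_row_closed cD.
have step (q : nat * (T * nat)) : exists r : T * nat, K q.2.1 ->
    [/\ (q.2.2 < r.2)%N /\ agree q.2.2 q.2.1 r.1, K r.1,
      forall p, p.1 != q.1 -> r.1 p = q.2.1 p,
      exists j, r.1 (q.1, j) != q.2.1 (q.1, j) &
      (forall j, `|theta q.2.1 j - theta r.1 j| <= 2^-1 ^+ q.1 + 2^-1 ^+ q.1) /\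
      [set y | agree r.2 r.1 y] `<=` D q.1].
  case: q => n [x l] /=.
  have [Cx|nC] := pselect (K x); last by exists (x, l) => /nC.
  have : E_1 x (set_row n x row0).
    by exists n.+1 => m nm k; rewrite /set_row /= gtn_eqF.
  move=> /red/cvgrPdist_lt/(_ _ (half_gt0 n))[N _ hN].
  have /choice[s hs] j := @rat_approx R (theta x j - theta (set_row n x row0) j) _ (half_gt0 n).
  pose i := (n, n, mkseq s N).
  have Ax : A theta i x.
    move=> j; apply: ltW; rewrite /i /=; have [jN|Nj] := ltnP j N.
      by rewrite nth_mkseq.
    rewrite nth_default ?size_mkseq // rmorph0 subr0.
    by have := hN j Nj; rewrite /= sub0r normrN.
  have [cx _] := DC x (KD x Cx).
  have Ux : nbhs x (U i) by apply: open_nbhs_nbhs; split => //; exact/cx.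
  have [L hL] : exists L, forall z : cantor, (forall j, (j < L)%N -> x (n, j) = z j) ->
      U i (set_row n x z) /\ agree l x (set_row n x z).
    have := @set_row_continuousr n x (fun j => x (n, j)); rewrite /continuous_at set_row_id.
    move=> /(_ _ (filterI Ux (nbhs_agree x l))) /nbhs_agreeP[L hL].
    by exists L => z hz; exact: (hL z).
  (* The row is kept below [L], to stay in the open set, and altered at [L], to make the new row
     different. *)
  pose z0 : cantor := fun j => if (j < L)%N then x (n, j) else ~~ x (n, j).
  have [||z [/= z0z Cy]] := baire_space_ptws (rowC x Cx n) (O := [set z | agree L.+1 z0 z]).
  - by exists z0; exact: agree_refl.
  - exact: open_agree.
  have [|Uy ay] := hL z.
    by move=> j jL; rewrite -z0z /z0 ?jL // ltnW.
  set y := set_row n x z in Cy Uy ay *.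
  have [cy _] := DC y (KD y Cy).
  have [l' hl'] : exists l', [set w | agree l' y w] `<=` D n.
    apply/nbhs_agreeP; apply: open_nbhs_nbhs; split; first exact: (oD n).1.
    exact: KD.
  exists (y, maxn l.+1 l') => _; split => //=.
  - by split; rewrite ?leq_max ?leqnn.
  - by move=> p pn; rewrite /y /set_row (negbTE pn).
  - exists L; rewrite /y /set_row /= eqxx -z0z // /z0 ltnn.
    by case: (x (n, L)).
  split; last by move=> w /(agree_le (leq_maxr _ _)); exact: hl'.
  move=> j; have := Ax j; have := (cy i).2 Uy j; rewrite /i /=.
  (* Zeroing row [n] erases the change, so both images are compared with the same sequence. *)
  have -> : set_row n y row0 = set_row n x row0.
    by apply/funext => p; rewrite /y /set_row; case: eqP.
  rewrite !ler_norml => /andP[? ?] /andP[? ?].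
  by apply/andP; split; lra.
have [f hf] := choice step.
have [x0 [_ Cx0]] : setT `&` K !=set0.
  apply: baire_space_ptws => //; last exact: openT.
  by exists (fun=> false).
pose u := fix u n := if n is m.+1 then f (m, u m) else (x0, 0%N).
have Cu n : K (u n).1.
  by elim: n => //= n IH; have [] := hf (n, u n) IH.
have hu n := hf (n, u n) (Cu n).
have [y hy] := @agree_lim _ _ (fun n => (u n).1) (fun n => (u n).2)
  (fun n => let: And5 a _ _ _ _ := hu n in a).
have un n : (n <= (u n).2)%N.
  by elim: n => // n IH; apply: leq_ltn_trans IH _; have [[]] := hu n.
have before p m : (m <= p.1)%N -> (u m).1 p = x0 p.
  elim: m => // m IH mp; have [_ _ h _ _] := hu m.
  by rewrite h /= ?gtn_eqF // IH // ltnW.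
have after p m : (p.1 < m)%N -> (u m).1 p = (u p.1.+1).1 p.
  move=> /subnK <-; elim: (m - p.1.+1)%N => // k IH.
  have [_ _ h _ _] := hu (k + p.1.+1)%N.
  by rewrite addSn h //= ltn_eqF // addnS ltnS leq_addl.
have yE p : y p = (u p.1.+1).1 p.
  rewrite -(after p (maxn p.1 (pickle p)).+1) ?ltnS ?leq_maxl // (hy _ p) //.
  by apply: leq_trans (un _); rewrite ltnS leq_maxr.
have nE : ~ E_1 x0 y.
  move=> [m hm]; have [_ _ _ [j /eqP]] := hu m; rewrite (before (m, j)) //= => nj _.
  by apply: nj; rewrite (hm m (leqnn m) j) yE.
have Cy : (\bigcap_n D n) y.
  by move=> n _; have [_ _ _ _ [_]] := hu n; apply; exact: (hy n.+1).
(* Step [n] costs [2 * 2^-n = 4 * 2^-n - 4 * 2^-(n+1)], which telescopes. *)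
have bound n k j : `|theta (u n).1 j - theta (u (n + k)%N).1 j| <=
    4 * 2^-1 ^+ n - 4 * 2^-1 ^+ (n + k).
  elim: k => [|k IH]; first by rewrite addn0 !subrr normr0.
  have [_ _ _ _ [/(_ j) h _]] := hu (n + k)%N.
  rewrite addnS; apply: le_trans (ler_distD (theta (u (n + k)%N).1 j) _ _) _.
  by apply: le_trans (lerD IH h) _; rewrite /= exprS; lra.
(* The bound passes to the limit although [theta] is only Borel: [y] and its approximations lie in
   the comeager set on which preimages of rational balls are relatively open. *)
have boundy n j : `|theta (u n).1 j - theta y j| <= 4 * 2^-1 ^+ n.
  apply/ler_addgt0Pr => e e0.
  have [r [Bry Br]] := (countable_base_real R).2 (theta y j) (ball (theta y j) e)
    (nbhsx_ballx _ _ e0).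
  have [_ oy] := DC y Cy.
  have /nbhs_agreeP[l hl] : nbhs y (OV (j, r)).
    by apply: open_nbhs_nbhs; split => //; exact/oy.
  have [_ om] := DC _ (KD _ (Cu (n + l)%N)).
  have : V (j, r) (u (n + l)%N).1.
    apply/om/hl; apply: agree_sym; apply: agree_le (hy (n + l)%N).
    by apply: leq_trans (un _); exact: leq_addl.
  move=> /Br; rewrite -ball_normE /= distrC => h.
  apply: le_trans (ler_distD (theta (u (n + l)%N).1 j) _ _) _.
  apply: lerD (ltW h); apply: le_trans (bound n l j) _.
  by have := half_gt0 (n + l)%N; lra.
apply: nE; apply/red; apply/cvgrPdist_lt => e e0.
have [n hn] : exists n, 4 * 2^-1 ^+ n < e / 2 :> R.
  have e8 : 0 < e / 8 by rewrite divr_gt0.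
  by have [n hn] := half_expr_lt e8; exists n; lra.
have : E_1 x0 (u n).1.
  by exists n => m nm k; rewrite (before (m, k)).
move=> /red/cvgrPdist_lt/(_ (e / 2)); rewrite divr_gt0 // => /(_ isT).
apply: filterS => j; rewrite !sub0r !normrN => h.
apply: le_lt_trans (ler_distD (theta (u n).1 j) _ _) _.
rewrite [ltRHS]splitr; apply: ltrD => //.
exact: le_lt_trans (boundy n j) hn.
Qed.

End E1_not_c0.

(** * E_0^omega does not reduce to E_0 *)

Lemma comeager_bigcup_dense (T : topologicalType) (I : countType) (A : I -> set T) :
  baire_space T -> [set: T] !=set0 -> comeager (\bigcup_i A i) ->
  exists i, exists x : T, nbhs x (closure (A i)).
Proof.
move=> bT T0 cA; apply: contrapT => /forallNP h.
have cN i : comeager (~` closure (A i)).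
  apply: comeager_open; first exact/closed_openC/closed_closure.
  move=> V [x Vx] oV; apply: contrapT => nV; apply: (h i); exists x.
  have xV : nbhs x V by apply: open_nbhs_nbhs.
  apply: filterS xV => y Vy; apply: contrapT => nA; apply: nV; by exists y.
have [x [_ [[i _ Ax] /(_ i Logic.I)]]] := bT _ (comeagerI cA (comeager_bigcap cN)) setT T0 openT.
by apply; exact: subset_closure.
Qed.

Section Selector.
Local Notation W := {ptws bool * (nat * nat) -> bool}.
Local Notation T := {ptws nat * nat -> bool}.
Local Notation NN := {ptws nat -> nat}.

(** A point [w] holds two points of [T], called x and y below, under the tags [true] and [false];
    [e] chooses at each position which of them is copied. *)
Definition select (e : nat * nat -> bool) (w : W) : T := fun p => w (e p, p).

(** Overwriting in [w] the entries that [e] selects realises any [t]. This gives the openness of the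
    selection maps. *)
Lemma select_lift l : exists L, forall (w : W) e (t : T), agree L (select e w) t ->
  exists w', agree l w w' /\ select e w' = t.
Proof.
exists (\max_(i < l) (if unpickle (nat_of_ord i) is Some p
  then (pickle (p : bool * (nat * nat)).2).+1 else 0%N)) => w e t wt.
exists (fun p => if p.1 == e p.2 then t p.2 else w p); split; last first.
  by apply/funext => p; rewrite /select /= eqxx.
move=> p pl /=; case: eqP => // pe; rewrite -wt; first by rewrite /select -pe -surjective_pairing.
have := @leq_bigmax _ (fun i : 'I_l => if unpickle (nat_of_ord i) is Some p
  then (pickle (p : bool * (nat * nat)).2).+1 else 0%N) (Ordinal pl).
by rewrite /= pickleK.
Qed.

Lemma select_continuous e : continuous (select e).
Proof.
apply: continuous_prod_topology => p.
exact: (@proj_continuousT (bool * (nat * nat))%type (fun=> bool)).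
Qed.

Lemma select_open e (A : set W) : open A -> open (select e @` A).
Proof.
move=> oA; rewrite openE => _ [w Aw <-] /=.
have /nbhs_agreeP[l lA] : nbhs w A by apply: open_nbhs_nbhs.
have [L hL] := select_lift l; apply/nbhs_agreeP; exists L => t /hL[w' [ww' <-]].
by exists w' => //; exact: lA.
Qed.

Definition cut (f : nat -> nat) : nat * nat -> bool := fun p => (p.1 < f p.2)%N.

Lemma cut_continuous : continuous (fun q : W * NN => select (cut q.2) q.1).
Proof.
apply: continuous_prod_topology => p [w f] A /= /nbhs_singleton Ap.
exists ([set w' | agree (maxn (pickle (true, p)) (pickle (false, p))).+1 w w'],
  [set f' | agree p.2.+1 f f']) => /=; first by split; exact: nbhs_agree.
move=> [w' f'] [/= ww' ff']; rewrite /select /cut /= -(ff' p.2) ?ltnSn // -ww' //.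
by case: (p.1 < f p.2)%N; rewrite ltnS ?leq_maxl ?leq_maxr.
Qed.

Lemma cut_open (A : set (W * NN)) :
  open A -> open ((fun q => select (cut q.2) q.1) @` A).
Proof.
move=> oA; rewrite openE => _ [[w f] Awf <-] /=.
have [[V V'] /= [/nbhs_agreeP[l lV] V'f] VV] : nbhs (w, f) A by apply: open_nbhs_nbhs.
have [L hL] := select_lift l; apply/nbhs_agreeP; exists L => t /hL[w' [ww' <-]].
by exists (w', f) => //; apply: VV; split; [exact: lV | exact: nbhs_singleton].
Qed.

End Selector.

(* For generic x and y, column k of [select (cut f) w] is x below [f k] and y
   from [f k] on, so its image ranges over a single countable E_0-class.  Hence
   some fiber of this map of f is dense in an open set, and letting [f k] tend to
   infinity for large k gives a point that agrees with x there and yet has the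
   same image. *)
Theorem E0_omega_not_reducible_E0 : ~ borel_reducible E_0_omega E_0.
Proof.
move=> [theta bt red].
pose V (i : nat * bool) := [set x | theta x i.1 = i.2].
have bV i : borel_set (V i).
  apply: (bt [set y | y i.1 = i.2]); apply: borel_open.
  apply: (@open_comp _ _ (fun y : cantor => y i.1) [set b | b = i.2]); last exact: discrete_open.
  by move=> y _; exact: (@proj_continuousT nat (fun=> bool)).
have [U [oU cU]] := baire_property_family bV.
set C := [set x | _] in cU.
have bNN : countable_base (cyl_base (fun n => [set n]) : nat -> set {ptws nat -> nat}).
  by apply: countable_base_ptws; apply: (@countable_base_discrete nat id) => n; exists n.
have cC1 := comeager_sections bNN (comeager_preimage cut_continuous cut_open cU).
(* The limit of cuts that equal [s] on the first columns and tend to infinity on the others, where x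
   is copied entirely. *)
pose lim_cut (s : seq nat) (p : nat * nat) := (p.2 < size s)%N ==> (p.1 < nth 0%N s p.2)%N.
have cC2 := comeager_bigcap (fun s : seq nat =>
  comeager_preimage (@select_continuous (lim_cut s)) (@select_open (lim_cut s)) cU).
pose Dif (i : nat * nat) := [set w : {ptws bool * (nat * nat) -> bool} |
  exists2 n, (i.1 <= n)%N & w (true, (n, i.2)) != w (false, (n, i.2))].
have cD i : comeager (Dif i).
  case: i => m k; apply: comeager_open.
    rewrite openE => w [n /= mn wn]; apply/nbhs_agreeP.
    exists (maxn (pickle (true, (n, k))) (pickle (false, (n, k)))).+1 => v wv.
    by exists n => //=; rewrite -!wv // ltnS ?leq_maxl ?leq_maxr.
  move=> A [w Aw] oA; have /nbhs_agreeP[l lA] : nbhs w A by apply: open_nbhs_nbhs.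
  have [|M hM] := @injective_nat_unbounded (fun j => pickle (true, ((m + j)%N, k))) _ l.
    by move=> a b /(pcan_inj pickleK)[/addnI].
  exists (fun p => if p == (true, ((m + M)%N, k)) then ~~ w (false, ((m + M)%N, k)) else w p).
  split.
    apply: lA => p pl; case: eqP => // pE; move: pl; rewrite pE ltnNge.
    by rewrite hM.
  exists (m + M)%N; first exact: leq_addr.
  by rewrite /= eqxx; case: (w _).
have [|w [_ [[/= c1 c2] c3]]] := baire_space_ptws
  (comeagerI (comeagerI cC1 cC2) (comeager_bigcap cD)) (O := setT) _ openT.
  by exists (fun=> false).
pose y : {ptws nat * nat -> bool} := fun p => w (false, p).
(* As [s] varies, [v s] runs through the [E_0]-class of [theta y]. *)
pose v (s : seq bool) : cantor := fun n => if (n < size s)%N then nth false s n else theta y n.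
pose A (s : seq bool) := [set f : {ptws nat -> nat} | C (select (cut f) w) /\
  theta (select (cut f) w) = v s].
have cA : comeager (\bigcup_s A s).
  apply: comeagerS c1 => f Cf.
  have : E_0_omega (select (cut f) w) y.
    by move=> k; exists (f k) => n fn; rewrite /select /cut /= ltnNge fn.
  move=> /red[m hm]; exists (mkseq (theta (select (cut f) w)) m) => //; split => //.
  apply/funext => n; rewrite /v size_mkseq; case: ltnP => nm; last exact: hm.
  by rewrite nth_mkseq.
have [|s [f0 /nbhs_agreeP[l hl]]] := comeager_bigcup_dense (@baire_space_ptws _ _) _ cA.
  by exists (fun=> 0%N).
(* Density provides members of [A s] that follow [f0] below [l] and have the value [i] on the
   further columns below [i]. *)
have /choice[h hh] i : exists h, A s h /\
    agree (maxn l i) (fun k => if (k < l)%N then f0 k else i) h.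
  have : closure (A s) ((fun k => if (k < l)%N then f0 k else i) : {ptws nat -> nat}).
    by apply: hl => k kl /=; rewrite kl.
  by move=> /(_ _ (nbhs_agree _ (maxn l i)))[g [? ?]]; exists g.
pose zs := select (lim_cut (mkseq f0 l)) w.
have Czs : C zs by apply: (c2 (mkseq f0 l) I).
have cvz : (fun i => select (cut (h i)) w) @ \oo --> zs.
  apply/(@cvg_prod_topologyP _ (fun=> bool)) => -[n k] B /nbhs_singleton Bz.
  exists (maxn n k).+1 => // i /= nki.
  suff -> : select (cut (h i)) w (n, k) = zs (n, k) by [].
  rewrite /zs /select /cut /lim_cut /= size_mkseq; have [_ hi] := hh i.
  rewrite -hi; last by rewrite leq_max (leq_trans _ nki) ?orbT // ltnS leq_maxr.
  have [kl|lk] /= := ltnP k l; first by rewrite nth_mkseq.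
  by rewrite (leq_trans _ nki) // ltnS leq_maxl.
(* The approximations all have the image [v s], and relative openness at the generic point [zs]
   transfers each bit to the limit. *)
have thz : theta zs = v s.
  apply/funext => j.
  have Uz : nbhs zs (U (j, theta zs j)).
    by apply: open_nbhs_nbhs; split => //; exact: ((Czs (j, theta zs j)).1 erefl).
  have [N _ /(_ N (leqnn N)) /= UN] := cvz _ Uz.
  have [[CN thN] _] := hh N.
  by rewrite -thN; have := (CN (j, theta zs j)).2 UN; rewrite /V /= => ->.
have : E_0 (theta zs) (theta y).
  by exists (size s) => n sn; rewrite thz /v ltnNge sn.
move=> /red/(_ l)[m hm].
have [n /= mn] := c3 (m, l) I.
have := hm n mn; rewrite /zs /select /lim_cut /y /= size_mkseq ltnn /= => ->.
by rewrite eqxx.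
Qed.

(** * Reductions *)

Lemma near_forall_lt (P : nat -> nat -> Prop) m :
  (forall i, (i < m)%N -> \forall n \near \oo, P i n) ->
  \forall n \near \oo, forall i, (i < m)%N -> P i n.
Proof.
move=> h.
have H : \forall n \near \oo, forall i : 'I_m, P i n.
  by apply: filter_forall => i; apply: h.
by apply: filterS H => n hn i im; exact: (hn (Ordinal im)).
Qed.

Lemma near_neq (N : nat) : \forall n \near \oo, n <> N.
Proof. by exists N.+1 => // n /= Nn e; rewrite e ltnn in Nn. Qed.

Lemma near_injective_ge (a : nat -> nat) N : injective a -> \forall n \near \oo, (N <= a n)%N.
Proof.
move=> ai; have : \forall n \near \oo, forall i, (i < N)%N -> a n <> i.
  apply: near_forall_lt => i _.
  have [[n0 an0]|h] := pselect (exists n, a n = i).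
    by exists n0.+1 => // n /= n0n an; move: n0n; rewrite (ai n n0) ?ltnn // an.
  by exists 0%N => // n _ an; apply: h; exists n.
by apply: filterS => n hn; rewrite leqNgt; apply/negP => /hn.
Qed.

Lemma infinite_unbounded (A : set nat) :
  infinite_set A <-> forall N, exists2 i, (N <= i)%N & A i.
Proof.
split=> [iA N|h /finite_seqP[s As]].
  apply: contrapT => h; apply: iA; apply: sub_finite_set (finite_II N) => i Ai /=.
  by rewrite ltnNge; apply/negP => Ni; apply: h; exists i.
have [i si] := h (\max_(j <- s) j).+1; rewrite As /= => js.
by move: si; rewrite ltnNge (leq_bigmax_seq _ js).
Qed.

(** The terms of a strictly increasing sequence are taken from the sets in turn, term [pickle p]
    from [J p.2], so a single injection visits every set infinitely often. *)
Lemma injection_into_unbounded (J : nat -> set nat) :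
  (forall k N, exists2 i, (N <= i)%N & J k i) ->
  exists a : nat * nat -> nat, injective a /\ forall p, J p.2 (a p).
Proof.
move=> hJ.
have /choice[f hf] (q : nat * nat) : exists i, (q.2 <= i)%N /\ J q.1 i.
  by have [i ? ?] := hJ q.1 q.2; exists i.
pose k n := if unpickle n is Some p then (p : nat * nat).2 else 0%N.
have [a [aS aJ]] : exists a : nat -> nat,
    (forall n, (a n < a n.+1)%N) /\ forall n, J (k n) (a n).
  exists (fix a n := if n is m.+1 then f (k n, (a m).+1) else f (k 0%N, 0%N)).
  by split=> [n|[|n]]; [exact: (hf (_, _)).1 | exact: (hf (_, _)).2 | exact: (hf (_, _)).2].
have ainj : injective a.
  have lt m n : (m < n)%N -> (a m < a n)%N.
    move=> /subnK <-; elim: (n - m.+1)%N => [|j IH]; first exact: aS.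
    exact: ltn_trans IH (aS _).
  by move=> m n amn; case: (ltngtP m n) => // /lt; rewrite amn ltnn.
exists (a \o pickle); split; first by apply: inj_comp => //; exact: pcan_inj pickleK.
move=> p /=; have -> : p.2 = k (pickle p) by rewrite /k pickleK.
exact: aJ.
Qed.

Lemma partial_inverse (I : Type) (a : I -> nat) : injective a ->
  exists b : nat -> option I, forall i p, b i = Some p <-> a p = i.
Proof.
move=> ai.
suff /choice[b hb] i : exists o : option I, forall p, o = Some p <-> a p = i by exists b.
have [[p ap]|h] := pselect (exists p, a p = i).
  exists (Some p) => p'; split=> [[<-//]|ap']; congr Some; apply: ai; by rewrite ap.
by exists None => p; split => // ap; case: h; exists p.
Qed.

Lemma borel_reducible_trans (T U V : topologicalType) (E : T -> T -> Prop)
    (F : U -> U -> Prop) (G : V -> V -> Prop) :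
  borel_reducible E F -> borel_reducible F G -> borel_reducible E G.
Proof.
move=> [f bf hf] [g bg hg]; exists (g \o f); first exact: borel_fun_comp.
by move=> x y; rewrite hf hg.
Qed.

Section Reductions.
Variables (R : realType) (X : nat -> topologicalType).
Hypothesis hX : forall n, polish R (X n).
Variable d : forall n, X n -> X n -> R.
Hypothesis hd : forall n, borel_pseudometric (@d n).

(** Separability passes to larger scales, so convergence of the infima means eventual separability
    at each scale, the form used from here on. *)
Lemma delta_of_cvg0 : ((fun n => delta_of (@d n)) @ \oo --> 0%E) <->
  forall e : R, 0 < e -> \forall n \near \oo, delta_separable (@d n) e.
Proof.
have ge0 n : (0 <= delta_of (@d n))%E.
  by apply: le_ereal_inf_tmp => _ [r [r0 _] <-]; rewrite lee_fin ltW.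
have le n (e : R) : 0 < e -> delta_separable (@d n) e -> (delta_of (@d n) <= e%:E)%E.
  by move=> e0 se; apply: ereal_inf_lbound; exists e.
split=> [/fine_cvgP[fn /cvgrPdist_lt h] e e0|h].
  apply: filterS2 fn (h e e0) => n fin; rewrite sub0r normrN /= => lt.
  have : (delta_of (@d n) < e%:E)%E.
    rewrite -(fineK fin) lte_fin; apply: le_lt_trans lt; exact: ler_norm.
  move=> /ereal_inf_lt[_ [r [r0 [S cS hS]] <-]]; rewrite lte_fin => re.
  by exists S => // u; have [s Ss us] := hS u; exists s => //; exact: lt_trans re.
apply/fine_cvgP; split.
  apply: filterS (h 1 ltr01) => n /(le n _ ltr01) => l1.
  by rewrite ge0_fin_numE // (le_lt_trans l1) // ltry.
apply/cvgrPdist_lt => e e0; have e2 : 0 < e / 2 by rewrite divr_gt0.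
apply: filterS (h _ e2) => n /(le n _ e2) l2; rewrite sub0r normrN /=.
have fin : delta_of (@d n) \is a fin_num by rewrite ge0_fin_numE // (le_lt_trans l2) // ltry.
rewrite ger0_norm ?fine_ge0 //.
have : fine (delta_of (@d n)) <= e / 2 by rewrite -lee_fin fineK.
by move=> h2; apply: le_lt_trans h2 _; lra.
Qed.

Lemma E_lim0P x y : E_lim0 d x y <->
  forall e : R, 0 < e -> \forall n \near \oo, d (x n) (y n) < e.
Proof.
have d0 n := pseudometric_ge0 (hd n).1 (x n) (y n).
split=> [/cvgrPdist_lt h e /h|h].
  by apply: filterS => n /=; rewrite sub0r normrN ger0_norm.
apply/cvgrPdist_lt => e /h; apply: filterS => n /=.
by rewrite sub0r normrN ger0_norm.
Qed.

Lemma borel_dist_section n (s : X n) :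
  borel_fun (fun x : prod_topology X => d (x n) s).
Proof.
apply: (@borel_fun_comp _ _ _ (fun x : prod_topology X => (x n, s)) (fun p => d p.1 p.2)).
  apply: borel_fun_continuous => x.
  have h1 : (fun x : prod_topology X => x n) @ x --> x n.
    exact: (@proj_continuousT nat X).
  have h2 : (fun _ : prod_topology X => s) @ x --> s.
    by apply: (@cvg_cst (X n) s _ (nbhs x)); exact: nbhs_filter.
  exact: cvg_pair h1 h2.
exact: (hd n).2.
Qed.

End Reductions.

(** * An embedding of Aharoni type into [c_0] *)

Section Bump.
Variables (R : realType) (X : Type) (d : X -> X -> R) (s : nat -> X) (r : R).
Hypothesis hd : is_pseudometric d.

(** The seed [4 * r] stands for an empty minimum: in [bump] it contributes [3 * r], which the other
    term never exceeds. *)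
Fixpoint first_dist (i : nat) (u : X) : R :=
  if i is j.+1 then Num.min (first_dist j u) (d u (s j)) else 4 * r.

Definition bump (i : nat) (u : X) : R :=
  Num.max 0 (Num.min (3 * r - d u (s i)) (first_dist i u - r)).

Lemma dist_lip u v w : d u w <= d v w + d u v.
Proof. by rewrite addrC; exact: (pseudometric_triangle hd). Qed.

Lemma first_dist_lip i u v : first_dist i u <= first_dist i v + d u v.
Proof.
elim: i => [|i IH] /=; first by rewrite lerDl (pseudometric_ge0 hd).
by rewrite addr_minl le_min !ge_min IH dist_lip orbT.
Qed.

Lemma bump_lip i u v : `|bump i u - bump i v| <= d u v.
Proof.
have one a b : bump i a <= bump i b + d a b.
  rewrite /bump addr_maxl ge_max add0r !le_max (pseudometric_ge0 hd) /= addr_minl.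
  apply/orP; right; rewrite le_min !ge_min; apply/andP; split; apply/orP.
    left; have := dist_lip b a (s i); rewrite (pseudometric_sym hd b a); lra.
  by right; have := first_dist_lip i a b; lra.
have h1 := one u v; have h2 := one v u; rewrite (pseudometric_sym hd v u) in h2.
by rewrite ler_norml; apply/andP; split; lra.
Qed.

Lemma first_dist_le i j u : (j < i)%N -> first_dist i u <= d u (s j).
Proof.
elim: i => // i IH; rewrite ltnS leq_eqVlt /= ge_min => /orP[/eqP->|/IH->//].
by rewrite lexx orbT.
Qed.

(** The point [s j] keeps [first_dist] below [r] at all later indices, which gives finite support at
    [u]. *)
Lemma bump_eq0 i j u : (j < i)%N -> d u (s j) < r -> bump i u = 0.
Proof.
move=> ji ur; apply/max_idPl; rewrite ge_min; apply/orP; right.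
by have := first_dist_le u ji; lra.
Qed.

Hypotheses (r0 : 0 < r) (hs : forall u, exists i, d u (s i) < r).

(** Let [i] be least with [d u (s i) < 2 * r]. All earlier distances are at least [2 * r], so the
    bump at [u] is at least [r]; and [v] is further than [3 * r] from [s i], where the bump
    vanishes. *)
Lemma bump_sep u v : 5 * r <= d u v -> exists i, r <= `|bump i u - bump i v|.
Proof.
move=> uv; have r_gt0 := r0.
have ex : exists i, d u (s i) < 2 * r.
  by have [i ui] := hs u; exists i; lra.
have [i ui imin] := ex_minnP ex; exists i.
have fd : 2 * r <= first_dist i u.
  have : forall j, (j <= i)%N -> 2 * r <= first_dist j u.
    elim=> [_|j IH ji] /=; first by lra.
    rewrite le_min IH ?(ltnW ji) //= leNgt; apply/negP => /imin.
    by rewrite leqNgt ji.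
  exact.
have -> : bump i v = 0.
  apply/max_idPl; rewrite ge_min; apply/orP; left.
  have := pseudometric_triangle hd u (s i) v; rewrite (pseudometric_sym hd (s i) v); lra.
rewrite subr0; apply: le_trans (ler_norm _).
rewrite /bump le_max; apply/orP; right; rewrite le_min; apply/andP; split; lra.
Qed.

Lemma borel_bump (T : topologicalType) (f : T -> X) i :
  (forall j, borel_fun (fun x => d (f x) (s j))) -> borel_fun (fun x => bump i (f x)).
Proof.
move=> hb; apply: borel_fun_max; first exact: borel_fun_cst.
apply: borel_fun_min; apply: borel_funB => //; try exact: borel_fun_cst.
elim: i => [|i IH] /=; first exact: borel_fun_cst.
exact: borel_fun_min.
Qed.

End Bump.

Section Reduction_to_c0.
Variables (R : realType) (X : nat -> topologicalType).
Hypothesis hX : forall n, polish R (X n).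
Variable d : forall n, X n -> X n -> R.
Hypothesis hd : forall n, borel_pseudometric (@d n).

Lemma separable_sequence n (e : R) : exists s : nat -> X n,
  delta_separable (@d n) e -> forall u, exists i, d u (s i) < e.
Proof.
have [[x0 _] _ _] := hX n.
have [[S cS hS]|nsep] := pselect (delta_separable (@d n) e); last by exists (fun=> x0).
have [|q [_ hq]] := countable_enum cS; first by have [s Ss _] := hS x0; exists s.
exists q => _ u; have [s Ss us] := hS u.
by have [i qi] := hq s Ss; exists i; rewrite qi.
Qed.

(** Late coordinates are controlled by the Lipschitz bound and early ones by finite support.
    Conversely, at a fixed scale the codes of the bumps on [X n] tend to infinity with [n], so
    [bump_sep] bounds the distances. *)
Theorem reducible_c0 :
  (forall e : R, 0 < e -> \forall n \near \oo, delta_separable (@d n) e) ->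
  borel_reducible (E_lim0 d) (@RN_c0 R).
Proof.
move=> sep.
pose r k : R := 2^-1 ^+ k.
have r0 k : 0 < r k by rewrite exprn_gt0.
have [s hs] : exists s : forall p : nat * nat, nat -> X p.1, forall p,
    delta_separable (@d p.1) (r p.2) -> forall u, exists i, d u (s p i) < r p.2.
  exists (fun p => projT1 (cid (@separable_sequence p.1 (r p.2)))) => p.
  exact: (projT2 (cid (@separable_sequence p.1 (r p.2)))).
(* The bound [k <= n] leaves finitely many scales for each [n], so each [x n] contributes finitely
   many nonzero terms. *)
pose g n k i (u : X n) : R :=
  if (k <= n)%N && `[< delta_separable (@d n) (r k) >]
  then bump (@d n) (s (n, k)) (r k) i u else 0.
pose theta (x : prod_topology X) : {ptws nat -> R} := fun m =>
  if @pickle_inv (nat * nat * nat)%type m is Some p then g p.1.1 p.1.2 p.2 (x p.1.1) else 0.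
have hp n := (hd n).1.
have glip n k i u v : `|g n k i u - g n k i v| <= d u v.
  rewrite /g; case: ifP => _; first exact: bump_lip.
  by rewrite subrr normr0 (pseudometric_ge0 (hp n)).
have gfin n k u : \forall m \near \oo, forall i, m = pickle (n, k, i) -> g n k i u = 0.
  have [sk|nsk] := pselect (delta_separable (@d n) (r k)); last first.
    by exists 0%N => // m _ i _; rewrite /g asboolF // andbF.
  have [j uj] := hs (n, k) sk u.
  have H : \forall m \near \oo, forall i, (i < j.+1)%N -> m <> pickle (n, k, i).
    by apply: near_forall_lt => i _; exact: near_neq.
  apply: filterS H => m hm i mi; rewrite /g; case: ifP => // _.
  apply: (bump_eq0 _ uj); rewrite ltnNge; apply/negP => ij.
  exact: (hm i ij mi).
exists theta.
  apply: (borel_fun_ptws (@countable_base_real R)) => m; rewrite /theta.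
  case: (pickle_inv m) => [[[n k] i]|]; last exact: borel_fun_cst.
  rewrite /g /=; case: (_ && _); last exact: borel_fun_cst.
  by apply: borel_bump => j; exact: borel_dist_section.
move=> x y; rewrite E_lim0P //; split=> [h|h e e0].
  apply/cvgrPdist_lt => e e0; have [N _ hN] := h e e0.
  have H : \forall m \near \oo, forall n, (n < N)%N -> forall k, (k < N)%N ->
      forall i, m = pickle (n, k, i) -> g n k i (x n) = 0 /\ g n k i (y n) = 0.
    apply: near_forall_lt => n _; apply: near_forall_lt => k _.
    by apply: filterS2 (gfin n k (x n)) (gfin n k (y n)) => m h1 h2 i mi; rewrite h1 // h2.
  apply: filterS H => m hm; rewrite sub0r normrN /theta.
  case mE : (pickle_inv m) => [[[n k] i]|]; last by rewrite subrr normr0.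
  have pm : m = pickle (n, k, i) by have := pickle_invK (T := (nat * nat * nat)%type) m; rewrite mE.
  have [Nn|nN] /= := leqP N n; first by apply: le_lt_trans (glip _ _ _ _ _) _; exact: hN.
  have [nk|kn] := ltnP n k; first by rewrite /g leqNgt nk subrr normr0.
  have [-> ->] := hm n nN k (leq_ltn_trans kn nN) i pm.
  by rewrite subrr normr0.
have [k hk] : exists k, 5 * r k < e.
  have e5 : 0 < e / 5 by rewrite divr_gt0.
  by have [k hk] := half_expr_lt e5; exists k; rewrite /r; lra.
have /cvgrPdist_lt/(_ _ (r0 k))[M _ hM] := h.
have H : \forall n \near \oo, forall m, (m < M)%N -> forall i : nat, pickle (n, k, i) <> m.
  apply: near_forall_lt => m _.
  case mE : (@pickle_inv (nat * nat * nat)%type m) => [p|].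
    apply: filterS (near_neq p.1.1) => n np i nm; apply: np.
    by move: mE; rewrite -nm pickleK_inv => -[<-].
  by exists 0%N => // n _ i nm; move: mE; rewrite -nm pickleK_inv.
apply: filterS3 H (sep _ (r0 k)) (nbhs_infty_ge k) => n hn sk kn.
rewrite ltNge; apply/negP => ed.
have [|i] := bump_sep (hp n) (r0 k) (hs (n, k) sk) (u := x n) (v := y n); first by lra.
apply/negP; rewrite -ltNge.
have Mp : (M <= pickle (n, k, i))%N by rewrite leqNgt; apply/negP => /hn; exact.
have := hM _ Mp; rewrite /= sub0r normrN /theta pickleK_inv /g /= kn asboolT //.
Qed.

End Reduction_to_c0.

Lemma choice_dep (I : Type) (T : I -> Type) (P : forall i, T i -> Prop) :
  (forall i, exists x, P i x) -> exists f : forall i, T i, forall i, P i (f i).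
Proof. by move=> h; exists (fun i => projT1 (cid (h i))) => i; exact: projT2 (cid (h i)). Qed.

(** * Reductions of [E_0_omega] and [E_1] to [E] *)

Section Lower_bounds.
Variables (R : realType) (X : nat -> topologicalType).
Hypothesis hX : forall n, polish R (X n).
Variable d : forall n, X n -> X n -> R.
Hypothesis hd : forall n, borel_pseudometric (@d n).

Section Spread.
Variables (T : topologicalType) (I : Type) (b : nat -> option I).
Variable F : forall i, I -> T -> X i.

Definition spread (pt : forall i, X i) (x : T) : prod_topology X :=
  fun i => if b i is Some p then F i p x else pt i.

Lemma borel_spread pt : (forall i p, continuous (F i p)) -> borel_fun (spread pt).
Proof.
move=> cF; apply: borel_fun_continuous; apply: continuous_prod_topology => i.
rewrite /spread; case: (b i) => [p|]; first exact: cF.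
by move=> x; exact: cvg_cst.
Qed.

End Spread.

Lemma prod_polish_inhabited : inhabited (forall i, X i).
Proof. by split=> i; have /cid[x _] := let: And3 h _ _ := hX i in h. Qed.

Lemma continuous_if_coord (S T : topologicalType) (f : S -> bool) (u v : T) :
  continuous f -> continuous (fun x => if f x then u else v).
Proof.
move=> cf; have : continuous (fun c : bool => if c then u else v).
  move=> c A /nbhs_singleton Ac; apply: open_nbhs_nbhs.
  by split; [exact: discrete_open | exact: Ac].
by move=> cg x; exact: (@continuous_comp _ _ _ f _ x (cf x) (cg (f x))).
Qed.

(** Bit [(n, k)] chooses between two points of coordinate [a (n, k)] at distance between [eps k] and
    [1/(k+1)]. The upper bounds make all but finitely many columns negligible at a given scale, and
    the lower bound forces each column to be eventually equal. *)
Theorem E0_omega_reducible : cond_star d -> borel_reducible E_0_omega (E_lim0 d).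
Proof.
move=> star; have [pt] := prod_polish_inhabited.
have c0 k : 0 < k.+1%:R^-1 :> R by rewrite invr_gt0.
have /choice[eps heps] k : exists e : R, 0 < e < k.+1%:R^-1 /\
    infinite_set [set i | exists u v : X i, e < d u v < k.+1%:R^-1].
  by have [e ? ?] := star _ (c0 k); exists e.
have hJ k := (infinite_unbounded _).1 (heps k).2.
have [a [ainj aJ]] := injection_into_unbounded hJ.
have [b hb] := partial_inverse ainj.
have ex (p : nat * nat) : exists q : X p.2 * X p.2,
    (exists u v : X p.2, eps p.1 < d u v < p.1.+1%:R^-1) ->
    eps p.1 < d q.1 q.2 < p.1.+1%:R^-1.
  have [[u [v uv]]|n] := pselect (exists u v : X p.2, eps p.1 < d u v < p.1.+1%:R^-1).
    by exists (u, v).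
  by exists (pt p.2, pt p.2) => /n.
have [q hq] := choice_dep ex.
pose F i (p : nat * nat) (x : {ptws nat * nat -> bool}) : X i :=
  if x p then (q (p.2, i)).1 else (q (p.2, i)).2.
exists (spread b F pt).
  apply: borel_spread => i p.
  apply: (@continuous_if_coord _ _ (fun x : {ptws nat * nat -> bool} => x p)).
  exact: (@proj_continuousT (nat * nat)%type (fun=> bool)).
have dr i (x : X i) : d x x = 0 by exact: pseudometric_refl (hd i).1 x.
have ds i (x y : X i) : d x y = d y x by exact: pseudometric_sym (hd i).1 x y.
have dF i p x y : F i p x = F i p y \/
    x p <> y p /\ d (F i p x) (F i p y) = d (q (p.2, i)).1 (q (p.2, i)).2.
  by rewrite /F; case: (x p) (y p) => -[]; [left|right|right|left] => //; split => //; rewrite ds.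
move=> x y; rewrite E_lim0P //; split=> [h e e0|h k].
  have [K] := ltr_add_invr e0; rewrite add0r => hK.
  have /choice[m hm] := h.
  have H : \forall i \near \oo, forall k, (k < K)%N -> forall n, (n < m k)%N -> i <> a (n, k).
    by apply: near_forall_lt => k _; apply: near_forall_lt => n _; exact: near_neq.
  apply: filterS H => i hi; rewrite /spread; case bi : (b i) => [[n k]|]; last by rewrite dr.
  have [->|[xy ->]] := dF i (n, k) x y; first by rewrite dr.
  have ai : a (n, k) = i by apply/hb.
  have [Kk|kK] /= := leqP K k.
    have /hq/andP[_] : exists u v : X (k, i).2, eps (k, i).1 < d u v < (k, i).1.+1%:R^-1.
      by rewrite /= -ai; exact: (aJ (n, k)).
    move=> /lt_trans; apply; apply: le_lt_trans hK.
    by rewrite lef_pV2 ?posrE // ler_nat.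
  case: (hi k kK n) => //; rewrite ltnNge; apply/negP => mn.
  by apply: xy; exact: hm.
have [/andP[ek0 _] _] := heps k.
have [N _ hN] := h _ ek0.
have [M _ hM] := @near_injective_ge (fun n => a (n, k)) N
  (fun n n' e => congr1 fst (ainj _ _ e)).
exists M => n Mn; apply: contrapT => xy.
have /andP[lq _] := hq (k, a (n, k)) (aJ (n, k)).
have := hN _ (hM n Mn); rewrite /spread /=.
rewrite (_ : b (a (n, k)) = Some (n, k)); last exact/hb.
have [e|[_ ->]] := dF (a (n, k)) (n, k) x y; last by move: lq => /= ? ?; lra.
exfalso; move: xy e lq ek0; rewrite /F /=.
by case: (x _) (y _) => -[] // _ ->; rewrite dr => ? ?; lra.
Qed.

Theorem E1_reducible :
  ~ (forall e : R, 0 < e -> \forall n \near \oo, delta_separable (@d n) e) ->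
  borel_reducible E_1 (E_lim0 d).
Proof.
move=> nsep; have [pt] := prod_polish_inhabited.
have [e e0 hJ] : exists2 e : R, 0 < e &
    forall N, exists2 i, (N <= i)%N & ~ delta_separable (@d i) e.
  apply: contrapT => h; apply: nsep => e e0; apply: contrapT => hn; apply: h; exists e => // N.
  apply: contrapT => hN; apply: hn; exists N => // i /= Ni.
  by apply: contrapT => ns; apply: hN; exists i.
have [a' [ainj' aJ']] := injection_into_unbounded (fun _ => hJ).
pose a n := a' (n, 0%N).
have aJ n : ~ delta_separable (@d (a n)) e := aJ' (n, 0%N).
have ainj : injective a by move=> m n /ainj'[].
have [b hb] := partial_inverse ainj.
have ex i : exists th : cantor -> X i, continuous th /\
    (~ delta_separable (@d i) e -> forall x y, x <> y -> e / 2 <= d (th x) (th y)).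
  have [s|ns] := pselect (delta_separable (@d i) e).
    by exists (fun=> pt i); split => // x; exact: cvg_cst.
  by have [th cth ht] := perfect_separated (hX i) (hd i) ns; exists th.
have [th hth] := choice_dep ex.
pose F i (n : nat) (x : {ptws nat * nat -> bool}) : X i := th i (fun k => x (n, k)).
exists (spread b F pt).
  apply: borel_spread => i n x.
  apply: (@continuous_comp _ _ _
    (fun x : {ptws nat * nat -> bool} => (fun k => x (n, k)) : cantor) (th i));
    last exact: (hth i).1.
  move: x; apply: continuous_prod_topology => k.
  exact: (@proj_continuousT (nat * nat)%type (fun=> bool)).
move=> x y; rewrite E_lim0P //; split=> [[m hm] r r0|h].
  have H : \forall i \near \oo, forall n, (n < m)%N -> i <> a n.
    by apply: near_forall_lt => n _; exact: near_neq.
  apply: filterS H => i hi; rewrite /spread; case bi : (b i) => [n|]; last first.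
    by rewrite (pseudometric_refl (hd i).1).
  have ai : a n = i by apply/hb.
  suff -> : F i n x = F i n y by rewrite (pseudometric_refl (hd i).1).
  rewrite /F; congr (th i _); apply/funext => k; apply: hm.
  by rewrite leqNgt; apply/negP => /hi; exact.
have e2 : 0 < e / 2 by rewrite divr_gt0.
have [N _ hN] := h _ e2.
have [M _ hM] := near_injective_ge N ainj.
exists M => n Mn k; apply: contrapT => xy.
have := hN _ (hM n Mn); rewrite /spread /=.
rewrite (_ : b (a n) = Some n); last exact/hb.
rewrite ltNge => /negP; apply; apply: (hth _).2; first exact: aJ.
by move=> /(congr1 (fun f => f k)).
Qed.

End Lower_bounds.

(** * The case where the condition (star) fails *)

Section Not_star.
Variables (R : realType) (X : nat -> topologicalType).
Hypothesis hX : forall n, polish R (X n).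
Variable d : forall n, X n -> X n -> R.
Hypothesis hd : forall n, borel_pseudometric (@d n).

(** The negation takes the form of a gap: for each [eps] below [c], almost every space has no
    distance strictly between [eps] and [c]. *)
Lemma not_cond_star : ~ cond_star d -> exists2 c : R, 0 < c &
  forall eps, 0 < eps < c -> exists N, forall i, (N <= i)%N -> forall u v : X i,
    d u v < c -> d u v <= eps.
Proof.
move=> nstar; apply: contrapT => h; apply: nstar => c c0.
apply: contrapT => hc; apply: h; exists c => // eps ec.
apply: contrapT => hN; apply: hc; exists eps => //.
apply/infinite_unbounded => N; apply: contrapT => nN; apply: hN.
exists N => i Ni u v uvc; rewrite leNgt; apply/negP => uve; apply: nN.
by exists i => //; exists u, v; rewrite uve.
Qed.

(* Below the gap at scale c, the relation [d u v < c] is an equivalence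
   relation on X_i with countably many classes, for almost every i. *)
Theorem not_star_bireducible :
  (forall e : R, 0 < e -> \forall n \near \oo, delta_separable (@d n) e) ->
  ~ cond_star d ->
  borel_bireducible (E_lim0 d) E_0 \/ trivial_rel (E_lim0 d).
Proof.
move=> sep /not_cond_star[c c0 gap]; have [pt] := prod_polish_inhabited hX.
have dr i (x : X i) : d x x = 0 by exact: pseudometric_refl (hd i).1 x.
have ds i (x y : X i) : d x y = d y x by exact: pseudometric_sym (hd i).1 x y.
have dt i (x y z : X i) : d x z <= d x y + d y z by exact: pseudometric_triangle (hd i).1 x y z.
(* By the gap, distances that are eventually below [c] already converge to 0. *)
have EP x y : E_lim0 d x y <-> \forall i \near \oo, d (x i) (y i) < c.
  rewrite E_lim0P //; split=> [h|h e e0]; first exact: h.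
  have [|N hN] := gap (Num.min e c / 2).
    by rewrite divr_gt0 ?lt_min ?e0 //= ltr_pdivrMr // gt_min; apply/orP; right; lra.
  apply: filterS2 h (nbhs_infty_ge N) => i dc Ni.
  apply: le_lt_trans (hN i Ni _ _ dc) _.
  by rewrite ltr_pdivrMr // gt_min; apply/orP; left; lra.
pose J : set nat := [set i | exists u v : X i, c <= d u v].
have [hJ|hJ] := pselect (forall N, exists2 i, (N <= i)%N & J i); last first.
  right=> x y; apply/EP; apply: contrapT => hn; apply: hJ => N.
  apply: contrapT => hN; apply: hn; exists N => // i /= Ni.
  rewrite ltNge; apply/negP => cd; apply: hN; exists i => //.
  by exists (x i), (y i).
left; split.
  (* With [c / 3], two distances below [c] add up to at most [2 * c / 3], which makes [d < c]
     transitive. *)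
  have [N0 hN0] : exists N, forall i, (N <= i)%N -> forall u v : X i, d u v < c -> d u v <= c / 3.
    by apply: gap; rewrite divr_gt0 //= ltr_pdivrMr //; lra.
  have [N1 _ hN1] := sep _ c0.
  pose N := maxn N0 N1.
  have exs i := @separable_sequence R X hX d i c.
  have [s hs] := choice_dep exs.
  pose code i k (u : X i) : Prop := d u (s i k) < c /\ forall j, (j < k)%N -> c <= d u (s i j).
  have code_ex i u : (N <= i)%N -> exists k, code i k u.
    move=> Ni; have ex : exists k, d u (s i k) < c.
      by apply: hs; apply: hN1; apply: leq_trans Ni; rewrite leq_maxr.
    have [k uk kmin] := ex_minnP ex; exists k; split => // j jk.
    by rewrite leNgt; apply/negP => /kmin; rewrite leqNgt jk.
  have close i (u v w : X i) : (N <= i)%N -> d u v < c -> d v w < c -> d u w < c.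
    move=> Ni uv vw; have N0i : (N0 <= i)%N by apply: leq_trans Ni; rewrite leq_maxl.
    by have := hN0 i N0i _ _ uv; have := hN0 i N0i _ _ vw; have := dt i u v w; lra.
  have code_eq i k (u v : X i) : (N <= i)%N -> d u v < c -> code i k u -> code i k v.
    move=> Ni uv [uk umin]; split; first by apply: (close _ _ u) => //; rewrite ds.
    move=> j jk; rewrite leNgt; apply/negP => vj.
    have : d u (s i j) < c by exact: close uv vj.
    by rewrite ltNge umin.
  (* For each [i >= N] exactly one bit [(i, k)] is set, so equality of almost all bits means
     equality of the class labels in almost all coordinates. *)
  pose theta (x : prod_topology X) : cantor := fun m =>
    if @pickle_inv (nat * nat)%type m is Some p then (N <= p.1)%N && `[< code p.1 p.2 (x p.1) >]
    else false.
  exists theta.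
    apply: (borel_fun_ptws (@countable_base_discrete bool odd _)).
      by case; [exists 1%N | exists 0%N].
    move=> m; rewrite /theta; case: (pickle_inv m) => [[i k]|]; last exact: borel_fun_cst.
    case: (N <= _)%N => /=; last exact: borel_fun_cst.
    apply: borel_fun_bool.
    have -> : [set x : prod_topology X | `[< code i k (x i) >]] = [set x | d (x i) (s i k) < c] `&`
        \bigcap_j (if (j < k)%N then ~` [set x | d (x i) (s i j) < c] else setT).
      apply/seteqP; split=> x /=.
        move=> /asboolP[h1 h2]; split => // j _; case: ifP => // jk /=.
        by rewrite ltNge h2.
      move=> [h1 h2]; apply/asboolP; split => // j jk; have := h2 j I.
      by rewrite jk /= leNgt => /negP.
    apply: borel_setI; first by apply: borel_lt; exact: borel_dist_section.
    apply: borel_bigcap => j; case: ifP => _; last by apply: borel_open; exact: openT.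
    by apply: borel_setC; apply: borel_lt; exact: borel_dist_section.
  move=> x y; split=> [/EP[M _ hM]|[m hm]].
    have fin i (u : X i) : \forall m \near \oo, forall k,
        m = pickle (i, k) -> (N <= i)%N -> ~ code i k u.
      have [Ni|iN] := leqP N i; last by exists 0%N => // m _ k _.
      have [k0 ck0] := code_ex i u Ni.
      apply: filterS (near_neq (pickle (i, k0))) => m mn k mk _ [uk umin].
      apply: mn; rewrite mk; congr (pickle (i, _)); have [u0 min0] := ck0.
      by case: (ltngtP k k0) => // [/min0|/umin]; rewrite leNgt ?u0 ?uk.
    have H : \forall m \near \oo, forall i, (i < M)%N -> forall k : nat, m = pickle (i, k) ->
        (N <= i)%N -> ~ code i k (x i) /\ ~ code i k (y i).
      apply: near_forall_lt => i _; apply: filterS2 (fin i (x i)) (fin i (y i)) => m h1 h2 k mk Ni.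
      by split; [exact: h1 | exact: h2].
    have [m _ hm] := H; exists m => n mn; rewrite /theta.
    case nE : (pickle_inv n) => [[i k]|] //=.
    have pn : n = pickle (i, k) by have := pickle_invK (T := (nat * nat)%type) n; rewrite nE.
    have [Ni|//] := leqP N i; rewrite /=.
    have [Mi|iM] := leqP M i.
      apply/asboolP/asboolP; apply: code_eq => //; first exact: hM.
      by rewrite ds; exact: hM.
    by have [h1 h2] := hm n mn i iM k pn Ni; rewrite !asboolF.
  have H : \forall i \near \oo, forall n, (n < m)%N -> forall k : nat, pickle (i, k) <> n.
    apply: near_forall_lt => n _.
    case nE : (@pickle_inv (nat * nat)%type n) => [p|].
      apply: filterS (near_neq p.1) => i ip k ni; apply: ip.
      by move: nE; rewrite -ni pickleK_inv => -[<-].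
    by exists 0%N => // i _ k ni; move: nE; rewrite -ni pickleK_inv.
  apply/EP; apply: filterS2 H (nbhs_infty_ge N) => i hi Ni.
  have [k ck] := code_ex i (x i) Ni.
  have := hm (pickle (i, k)); rewrite leqNgt; have -> : (pickle (i, k) < m)%N = false.
    by apply/negP => /hi/(_ k); exact.
  move=> /(_ isT); rewrite /theta pickleK_inv /= Ni asboolT //= => /esym/asboolP cy.
  by apply: (close _ _ (s i k)) => //; [exact: ck.1 | rewrite ds; exact: cy.1].
have [a' [ainj' aJ']] := injection_into_unbounded (fun _ => hJ).
pose a n := a' (n, 0%N).
have aJ n : J (a n) := aJ' (n, 0%N).
have ainj : injective a by move=> m n /ainj'[].
have [b hb] := partial_inverse ainj.
have ex i : exists q : X i * X i, J i -> c <= d q.1 q.2.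
  have [[u [v uv]]|nJ] := pselect (J i); first by exists (u, v).
  by exists (pt i, pt i) => /nJ.
have [q hq] := choice_dep ex.
pose F i (n : nat) (x : cantor) : X i := if x n then (q i).1 else (q i).2.
exists (spread b F pt).
  apply: borel_spread => i n; apply: (@continuous_if_coord _ _ (fun x : cantor => x n)).
  exact: (@proj_continuousT nat (fun=> bool)).
move=> x y; split=> [[m hm]|/EP[N _ hN]].
  apply/EP; have H : \forall i \near \oo, forall n, (n < m)%N -> i <> a n.
    by apply: near_forall_lt => n _; exact: near_neq.
  apply: filterS H => i hi; rewrite /spread; case bi : (b i) => [n|]; last by rewrite dr.
  have ai : a n = i by apply/hb.
  rewrite /F hm ?dr // leqNgt; apply/negP => /hi; exact.
have [M _ hM] := near_injective_ge N ainj.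
exists M => n Mn; have := hN _ (hM n Mn); rewrite /spread /=.
rewrite (_ : b (a n) = Some n); last exact/hb.
have := hq _ (aJ n); rewrite /F.
by case: (x n) (y n) => -[] // h; rewrite ?[d (q _).2 _]ds ltNge h.
Qed.

End Not_star.

(** * Assembling the three equivalences *)

Lemma E0_reducible_c0 (R : realType) : borel_reducible E_0 (@RN_c0 R).
Proof.
exists (fun (x : cantor) n => (x n)%:R).
  apply: borel_fun_continuous.
  apply: (@continuous_prod_topology _ _ (fun=> R)) => n.
  have -> : (fun x : cantor => (x n)%:R : R) = (fun x => if x n then 1 else 0).
    by apply/funext => x; case: (x n).
  apply: (@continuous_if_coord _ _ (fun x : cantor => x n)).
  exact: (@proj_continuousT nat (fun=> bool)).
move=> x y; split=> [[m hm]|/cvgrPdist_lt/(_ 1 ltr01)[m _ hm]].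
  apply/cvgrPdist_lt => e e0; exists m => // n mn.
  by rewrite /= hm // !subrr normr0.
exists m => n mn; have := hm n mn; rewrite /= sub0r normrN.
by case: (x n) (y n) => -[] //; rewrite ?subr0 ?sub0r ?normrN normr1 ltxx.
Qed.

Lemma borel_reducible_trivial (T U : topologicalType) (E : T -> T -> Prop)
    (F : U -> U -> Prop) : borel_reducible E F -> trivial_rel F -> trivial_rel E.
Proof. by move=> [f _ hf] tF x y; apply/hf. Qed.

Lemma E1_not_trivial : ~ trivial_rel E_1.
Proof.
move=> /(_ (fun=> true) (fun=> false))[m /(_ m (leqnn m) 0%N)].
by [].
Qed.

Lemma E0_omega_not_trivial : ~ trivial_rel E_0_omega.
Proof.
by move=> /(_ (fun=> true) (fun=> false) 0%N)[m /(_ m (leqnn m))].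
Qed.

Theorem corollary4p2 (R : realType) (X : nat -> topologicalType)
    (hX : forall n, polish R (X n))
    (d : forall n, X n -> X n -> R)
    (hd : forall n, borel_pseudometric (d n)) :
  [/\ ((fun n => delta_of (d n)) @ \oo --> 0%E /\ ~ cond_star d) <->
        (borel_bireducible (E_lim0 d) E_0 \/ trivial_rel (E_lim0 d)),
      ((fun n => delta_of (d n)) @ \oo --> 0%E /\ cond_star d) <->
        (borel_reducible E_0_omega (E_lim0 d) /\
         borel_reducible (E_lim0 d) (@RN_c0 R)) &
      ~ ((fun n => delta_of (d n)) @ \oo --> 0%E) <->
        borel_reducible E_1 (E_lim0 d)].
Proof.
have [fromD toD] := delta_of_cvg0 d.
(* Reducibility of [E] to [RN_c0] excludes [E_1] below [E], and without [E_1] below [E] the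
   separability radii converge to 0. This recovers the limit from a reduction to [RN_c0]. *)
have E1D : borel_reducible (E_lim0 d) (@RN_c0 R) -> ~ borel_reducible E_1 (E_lim0 d).
  by move=> Ec /borel_reducible_trans/(_ Ec)/E1_not_reducible_c0.
have D_of : ~ borel_reducible E_1 (E_lim0 d) -> (fun n => delta_of (d n)) @ \oo --> 0%E.
  move=> n1; apply: toD; apply: contrapT => /(E1_reducible hX hd); exact: n1.
split.
- split=> [[/fromD sep nstar]|[[EE0 E0E]|tE]]; first exact: not_star_bireducible.
    split; last first.
      move=> /(E0_omega_reducible hX hd)/borel_reducible_trans/(_ EE0).
      exact: E0_omega_not_reducible_E0.
    by apply/D_of/E1D/(borel_reducible_trans EE0)/E0_reducible_c0.
  split; last first.
    by move=> /(E0_omega_reducible hX hd)/borel_reducible_trivial/(_ tE)/E0_omega_not_trivial.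
  by apply: D_of => /borel_reducible_trivial/(_ tE)/E1_not_trivial.
- split=> [[/fromD sep star]|[E0E Ec]].
    by split; [exact: E0_omega_reducible | exact: reducible_c0].
  have D0 := D_of (E1D Ec); split => //.
  apply: contrapT => /(not_star_bireducible hX hd (fromD D0))[[EE0 _]|tE].
    exact: (E0_omega_not_reducible_E0 (borel_reducible_trans E0E EE0)).
  exact: (E0_omega_not_trivial (borel_reducible_trivial E0E tE)).
- split=> [nD|E1E /fromD sep].
    by apply: E1_reducible => // sep; apply: nD; apply: toD.
  exact: (E1D (reducible_c0 hX hd sep)).
Qed.
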